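(* Let $G$ be a finite connected simple graph with minimum degree at least two that is not a cycle and has at least one ordinary thread. If $s<1/3$, then $$C_h+C_k<sD$$ for every pair of distinct ordinary threads $h,k$ of $G$ (with a selected edge on each of them).
   Context: $R_N(x,y)$ denotes effective resistance in a graph (unit resistors on all edges) or in a network (multigraph with positive edge resistances). Threads. Let $H=\{v\in V(G):d_G(v)\ge3\}$. A thread of $G$ is a maximal path (of length at least one) whose internal vertices have degree two in $G$ and whose ends lie in $H$; the two ends may coincide. It is an ordinary thread if its ends are distinct and a loop thread if they coincide. The threads partition $E(G)$. Core. The expanded ordinary core $\widetilde B$ is the graph obtained from $G$ by deleting the internal vertices and the edges of all loop threads (retaining their roots). Put $D=\max_{x,y\in V(\widetilde B)}R_{\widetilde B}(x,y)$. The network $B$ has vertex set $H$ and, for each ordinary thread, one edge joining its two ends with resistance equal to its length (parallel edges allowed). Parameters. For an ordinary thread $h$ with vertices $u_h=v_0,v_1,\dots,v_{L_h}=v_h$ (length $L_h$), put $p_h=d_G(u_h)$, $q_h=d_G(v_h)$ (degrees in the full graph $G$), $a_h=1/p_h$, $b_h=1/q_h$, $\delta_h=1-a_h-b_h$, $\tau_h=L_h-\delta_h$, $\rho_h=R_B(u_h,v_h)$. With $g$ ranging over all ordinary threads, put $$s=\min\Bigl\{\tfrac13,\min_g\tfrac{\delta_g}{L_g}\Bigr\}.$$ If the selected edge on $h$ is $v_{m_h}v_{m_h+1}$ with $0\le m_h\le L_h-1$, put $$t_h=\frac{m_h+a_h}{\tau_h},\qquad \varepsilon_h=\Bigl(t_h-\frac{m_h}{L_h}\Bigr)\Bigl(\frac{m_h+1}{L_h}-t_h\Bigr),$$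 $$C_h=(sL_h-\delta_h)\,t_h(1-t_h)+(1-s)(L_h-\rho_h)\,\varepsilon_h .$$ *)

(* Defs.v *)
From mathcomp Require Import all_boot all_order all_algebra.
Set Implicit Arguments. Unset Strict Implicit. Unset Printing Implicit Defensive.
Import Order.TTheory GRing.Theory Num.Theory.
Local Open Scope ring_scope.

(** * Networks and effective resistance *)

(* Edges are listed once; the order of the two ends is immaterial. *)
Record network (R : realFieldType) (V : finType) := Network {
  edge : finType;
  src : edge -> V;
  tgt : edge -> V;
  res : edge -> R;
  res_gt0 : forall g : edge, 0 < res g }.

Definition dipole (R : realFieldType) (V : finType) (x y : V) : 'rV[R]_#|V| :=
  delta_mx 0 (enum_rank x) - delta_mx 0 (enum_rank y).

Definition laplacian (R : realFieldType) (V : finType) (N : network R V) :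
    'M[R]_#|V| :=
  \sum_(g : edge N) (res g)^-1 *:
    ((dipole R (src g) (tgt g))^T *m dipole R (src g) (tgt g)).

(* [dipole x y *m pinvmx (laplacian N)] is a potential for the unit current
   from x to y when x and y are connected; the value does not depend on the
   generalized inverse, by [eff_res_potential]. *)
Definition eff_res (R : realFieldType) (V : finType) (N : network R V)
    (x y : V) : R :=
  (dipole R x y *m pinvmx (laplacian N) *m (dipole R x y)^T) 0 0.

(* Ohm's law and Kirchhoff's node law for a unit current entering at x and
   leaving at y. *)
Definition unit_potential (R : realFieldType) (V : finType) (N : network R V)
    (x y : V) (phi : V -> R) : Prop :=
  forall v : V,
    \sum_(g : edge N | src g == v) (phi (src g) - phi (tgt g)) / res g
    + \sum_(g : edge N | tgt g == v) (phi (tgt g) - phi (src g)) / res g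
    = (v == x)%:R - (v == y)%:R.

Lemma dipoleE (R : realFieldType) (V : finType) (x y v : V) :
  dipole R x y 0 (enum_rank v) = (v == x)%:R - (v == y)%:R.
Proof. by rewrite !mxE !eqxx /= !(inj_eq enum_rank_inj). Qed.

Lemma mul_dipole (R : realFieldType) (V : finType) (x y : V) (u : 'rV[R]_#|V|) :
  (u *m (dipole R x y)^T) 0 0 = u 0 (enum_rank x) - u 0 (enum_rank y).
Proof.
by rewrite /dipole linearB /= mulmxBr !trmx_delta -!colE !mxE.
Qed.

Lemma eff_res_potential (R : realFieldType) (V : finType) (N : network R V)
    (x y : V) (phi : V -> R) :
  unit_potential N x y phi -> eff_res N x y = phi x - phi y.
Proof.
move=> Hphi; pose u : 'rV[R]_#|V| := \row_i phi (enum_val i).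
have uE v : u 0 (enum_rank v) = phi v by rewrite mxE enum_rankK.
set L := laplacian N.
have LT : L^T = L.
  rewrite /L /laplacian linear_sum /=; apply: eq_bigr => g _.
  by rewrite linearZ /= trmx_mul trmxK.
have uL : u *m L = dipole R x y.
  apply/rowP => i; rewrite -[i]enum_valK; move: (enum_val i) => v.
  rewrite dipoleE -Hphi /L /laplacian mulmx_sumr summxE.
  rewrite (big_mkcond (fun g => src g == v)) (big_mkcond (fun g => tgt g == v)).
  rewrite -big_split /=; apply: eq_bigr => g _.
  rewrite -scalemxAr mulmxA mxE [X in _ * X]mxE big_ord1 mul_dipole !uE dipoleE.
  rewrite !(eq_sym v); have [sv|_] := eqVneq (src g) v;
    have [tv|_] := eqVneq (tgt g) v; rewrite /= ?subr0 ?sub0r ?addr0 ?add0r.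
  - by rewrite subrr mulr0 mulr0 -mulrDl -opprB addNr mul0r.
  - by rewrite mulr1 mulrC.
  - by rewrite mulrN1 opprB mulrC.
  - by rewrite !mulr0.
have sub : (dipole R x y <= L)%MS by rewrite -uL submxMl.
rewrite /eff_res -/L -{2}uL trmx_mul LT mulmxA mulmxKpV //.
rewrite -[in RHS](uE x) -[in RHS](uE y) -mul_dipole.
by rewrite -[u *m _]trmxK trmx_mul trmxK [RHS]mxE.
Qed.

(* A simple graph with a unit resistor on every edge. *)
Definition unit_network (R : realFieldType) (V : finType) (e : rel V) :
    network R V :=
  @Network R V
    {p : V * V | e p.1 p.2 && (enum_rank p.1 < enum_rank p.2)%N}
    (fun p => (val p).1) (fun p => (val p).2) (fun=> 1) (fun=> ltr01).

(** * Graphs and threads *)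

Definition deg (T : finType) (e : rel T) (x : T) : nat := #|[set y | e x y]|.

Definition is_cycle_graph (T : finType) (e : rel T) : Prop :=
  exists c : seq T, [/\ uniq c, c =i T, (2 < size c)%N &
    forall x y, e x y = (y == next c x) || (y == prev c x)].

Definition is_branch (T : finType) (e : rel T) (x : T) : bool :=
  (3 <= deg e x)%N.

(* The vertex sequence v_0, v_1, ..., v_L is the pair (v_0, [v_1; ...; v_L]);
   the bound loses nothing, as v_1, ..., v_L are distinct in a thread. *)
Definition walk (T : finType) : finType := (T * {bseq #|T| of T})%type.

Definition len (T : finType) (w : walk T) : nat := size w.2.
Definition first (T : finType) (w : walk T) : T := w.1.
Definition final (T : finType) (w : walk T) : T := last w.1 w.2.
Definition inner (T : finType) (w : walk T) : seq T := behead (belast w.1 w.2).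
Definition edges (T : finType) (w : walk T) : {set {set T}} :=
  [set E in pairmap (fun x y => [set x; y]) w.1 w.2].

Definition is_open_path (T : finType) (e : rel T) (w : walk T) : bool :=
  path e w.1 w.2 && uniq (w.1 :: w.2).

Definition is_closed_path (T : finType) (e : rel T) (w : walk T) : bool :=
  [&& path e w.1 w.2, final w == first w, uniq w.2 & (3 <= len w)%N].

(* A thread together with a direction of traversal.  Maximality need not be
   required: a longer path would have an end of this one, of degree at least 3,
   as an internal vertex; see [thread_maximal]. *)
Definition is_thread (T : finType) (e : rel T) (w : walk T) : bool :=
  [&& (0 < len w)%N, is_open_path e w || is_closed_path e w,
      is_branch e (first w), is_branch e (final w)
    & all (fun v => deg e v == 2%N) (inner w)].

Lemma thread_maximal (T : finType) (e : rel T) (w w' : walk T) :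
  is_thread e w -> is_thread e w' ->
  infix (w.1 :: w.2) (w'.1 :: w'.2) -> w = w'.
Proof.
case: w => x [p szp]; case: w' => x' [p' szp'].
rewrite /is_thread /first /final /inner /len /=.
case/and5P=> p0 _ bx bl _; case/and5P=> _ _ _ _ /allP inn.
have bad v : is_branch e v -> v \in behead (belast x' p') -> False.
  by move=> bv /inn /eqP dv; rewrite /is_branch dv in bv.
case/(@infixP _ (x :: p) (x' :: p')) => -[|y s1] [s2] /= [].
- move=> exx ep; subst x'; case: s2 => [|z s2] in ep.
    by rewrite cats0 in ep; subst p'; congr pair; apply: val_inj.
  case: (bad _ bl); rewrite ep; case: p p0 {szp bx bl ep} => //= a p _.
  by rewrite belast_cat /= mem_cat in_cons -[last a p]/(last a p) eqxx orbT.
- move=> _ ep; case: (bad _ bx); rewrite ep.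
  case: p p0 {szp bl ep} => // a p _.
  by case: s1 => [|b s1] /=; rewrite ?inE ?eqxx // belast_cat mem_cat /= !inE
    eqxx ?orbT.
Qed.

Definition is_ordinary (T : finType) (e : rel T) (w : walk T) : bool :=
  is_thread e w && (first w != final w).
Definition is_loop (T : finType) (e : rel T) (w : walk T) : bool :=
  is_thread e w && (first w == final w).

(* Each ordinary thread occurs here twice, once for each direction.  Reversing
   the direction exchanges the edge m with the edge L - 1 - m, hence t with
   1 - t, and a with b, and leaves [eps_] and [C_] unchanged. *)
Definition othread (T : finType) (e : rel T) : finType :=
  {w : walk T | is_ordinary e w}.

Definition olen (T : finType) (e : rel T) (h : othread e) : nat := len (val h).

Lemma olen_gt0 (R : realFieldType) (T : finType) (e : rel T) (h : othread e) :
  0 < (olen h)%:R :> R.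
Proof. by rewrite ltr0n; case/andP: (valP h) => /and5P[]. Qed.

Definition same_thread (T : finType) (e : rel T) (h k : othread e) : bool :=
  edges (val h) == edges (val k).

(** * The expanded ordinary core *)

Definition core_vertex (T : finType) (e : rel T) : finType :=
  {v : T | ~~ [exists w : walk T, is_loop e w && (v \in inner w)]}.

Definition core_rel (T : finType) (e : rel T) : rel (core_vertex e) :=
  fun x y => e (val x) (val y) &&
    ~~ [exists w : walk T, is_loop e w && ([set val x; val y] \in edges w)].

(* Effective resistances are nonnegative, so the default 0 is harmless. *)
Definition core_diam (R : realFieldType) (T : finType) (e : rel T) : R :=
  \big[Num.max/0]_(x : core_vertex e) \big[Num.max/0]_(y : core_vertex e)
    eff_res (unit_network R (@core_rel T e)) x y.

(** * The network on the branch vertices *)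

Definition branch (T : finType) (e : rel T) : finType :=
  {v : T | is_branch e v}.

Lemma first_branch (T : finType) (e : rel T) (h : othread e) :
  is_branch e (first (val h)).
Proof. by case/andP: (valP h) => /and5P[]. Qed.

Lemma final_branch (T : finType) (e : rel T) (h : othread e) :
  is_branch e (final (val h)).
Proof. by case/andP: (valP h) => /and5P[]. Qed.

Definition ofirst (T : finType) (e : rel T) (h : othread e) : branch e :=
  exist _ (first (val h)) (first_branch h).
Definition ofinal (T : finType) (e : rel T) (h : othread e) : branch e :=
  exist _ (final (val h)) (final_branch h).

(* The condition on ranks keeps exactly one direction of every ordinary
   thread, hence one edge per thread. *)
Definition branch_network (R : realFieldType) (T : finType) (e : rel T) :
    network R (branch e) :=
  @Network R (branch e)
    {h : othread e | (enum_rank (ofirst h) < enum_rank (ofinal h))%N}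
    (fun h => ofirst (val h)) (fun h => ofinal (val h))
    (fun h => (olen (val h))%:R) (fun h => olen_gt0 R (val h)).

(** * Parameters of an ordinary thread *)

Definition a_ (R : realFieldType) (T : finType) (e : rel T) (h : othread e) : R :=
  (deg e (first (val h)))%:R^-1.
Definition b_ (R : realFieldType) (T : finType) (e : rel T) (h : othread e) : R :=
  (deg e (final (val h)))%:R^-1.
Definition delta_ (R : realFieldType) (T : finType) (e : rel T)
    (h : othread e) : R := 1 - a_ R h - b_ R h.
Definition tau_ (R : realFieldType) (T : finType) (e : rel T)
    (h : othread e) : R := (olen h)%:R - delta_ R h.
Definition rho_ (R : realFieldType) (T : finType) (e : rel T)
    (h : othread e) : R := eff_res (branch_network R e) (ofirst h) (ofinal h).

Definition s_ (R : realFieldType) (T : finType) (e : rel T) : R :=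
  \big[Num.min/3^-1]_(g : othread e) (delta_ R g / (olen g)%:R).

Definition t_ (R : realFieldType) (T : finType) (e : rel T)
    (h : othread e) (m : nat) : R := (m%:R + a_ R h) / tau_ R h.

Definition eps_ (R : realFieldType) (T : finType) (e : rel T)
    (h : othread e) (m : nat) : R :=
  (t_ R h m - m%:R / (olen h)%:R) * (m.+1%:R / (olen h)%:R - t_ R h m).

Definition C_ (R : realFieldType) (T : finType) (e : rel T)
    (h : othread e) (m : nat) : R :=
  (s_ R e * (olen h)%:R - delta_ R h) * t_ R h m * (1 - t_ R h m)
  + (1 - s_ R e) * ((olen h)%:R - rho_ R h) * eps_ R h m.

(* Main.v *)
Require Import Defs.
From mathcomp Require Import all_boot all_order all_algebra.
From mathcomp Require Import zify ring lra.
Set Implicit Arguments. Unset Strict Implicit. Unset Printing Implicit Defensive.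
Import Order.TTheory GRing.Theory Num.Theory.

(** Let g be a thread with s L_g = delta_g, which exists because s < 1/3; since
    delta_g >= 1/3, it has length L = L_g >= 2.  The first term of C_h is never
    positive and the second one decreases with rho_h, so that only lower bounds
    for effective resistances are needed, on both sides of the inequality.  By
    Dirichlet's principle ([eff_res_ge]) each of them comes from one well chosen
    potential.

    Lower bounds for D.  Write lam = floor(L/2) ceil(L/2) / L for the resistance
    between the middle of g and its two ends merged together.  A hat function on
    g together with a point mass at a core vertex w off g gives
    D >= lam + 1/deg w ([core_diam_hat]); if moreover the ends u, v of g are
    adjacent, the cut between g and the rest of the core gives
    D >= lam + 1/(deg u + deg v - 4) ([core_diam_cut]).
    Note that s lam is about delta_g/4 >= 1/12.

    Upper bounds for C_h.  Bounding the number of threads at each end of h by its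
    degree gives a lower bound for rho_h ([rho_ge]).  Hence C_h <= 1/24 + s/5 for
    every thread ([C_long]), C_h <= F(n) := 2/(n(n+2)) + (9/8) s (n-2)/n^2 for a
    thread of length one whose ends have degree sum n ([C_unit]), where
    F(6) = 1/24 + s/8, and a bound for C_g itself ([C_extremal]).

    If some core vertex off g has degree two, or if there is one of larger degree
    and u, v are adjacent vertices of degree three, then D >= lam + 1/2 and the
    bound 1/24 + s/5 for both threads suffices ([two_long_lt]).  Otherwise every thread
    other than g has length one, and there are four situations ([pair_lt]): the
    two threads differ from g, and then one of them ends off g, at a vertex whose
    degree improves F while it weakens the bound for D ([unit_pair]); one thread
    is g and the other one ends off g ([extremal_pair]); one is g and the other
    one is the edge u v, and the core has a vertex off g ([direct_pair]) or has
    none ([closed_pair]).  In the last situation u and v must carry loops, so they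
    have degree at least four.

    The bounds are equal, and strictness has to come from elsewhere, exactly
    when L = 3, u and v have degree three, and so has the vertex off g; there the
    potential of [core_diam_hat] violates the node law at u, and correcting it
    gives D > 1 ([core_diam_tie]). *)

(** * Threads as deterministic walks *)

(** A thread seen as a vertex sequence indexed by nat, values beyond L being
    irrelevant.  In this form the reversal of a thread is a mere change of index,
    and loop threads and ordinary threads are treated alike: the condition
    [arc_turn] is all that is left of the distinctness of the vertices. *)
Record is_arc (T : finType) (e : rel T) (x : nat -> T) (L : nat) : Prop := IsArc {
  arc_gt0 : 0 < L;
  arc_edge : forall i, i < L -> e (x i) (x i.+1);
  arc_deg : forall i, 0 < i < L -> deg e (x i) = 2;
  arc_turn : forall i, i.+1 < L -> x i != x i.+2;
  arc_head : is_branch e (x 0);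
  arc_last : is_branch e (x L) }.

Definition vtx (T : finType) (w : walk T) (i : nat) : T :=
  nth (first w) (w.1 :: w.2) i.

Lemma vtx_first (T : finType) (w : walk T) : vtx w 0 = first w.
Proof. by []. Qed.

Lemma vtx_final (T : finType) (w : walk T) : vtx w (len w) = final w.
Proof. exact: (nth_last (first w) (w.1 :: w.2)). Qed.

Lemma innerP (T : finType) (w : walk T) (v : T) :
  reflect (exists2 i, 0 < i < len w & v = vtx w i) (v \in inner w).
Proof.
case: w => x [p szp]; rewrite /inner /len /vtx /first /=.
case: p szp => [|y p] szp /=; first by apply: (iffP idP) => // -[[]].
have E i : i < size p -> nth y (belast y p) i = nth x (y :: p) i.
  by move=> lti; rewrite lastI nth_rcons size_belast lti; apply: set_nth_default;
    rewrite size_belast.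
apply: (iffP (nthP y)) => [[i]|[[|i] // lti ->]]; rewrite ?size_belast.
  by move=> lti <-; exists i.+1 => //=; rewrite E.
by exists i; rewrite ?E ?size_belast.
Qed.

Lemma path_turn (T : eqType) (x : T) (p : seq T) i : i.+1 < size p ->
  uniq (x :: p) || [&& last x p == x, uniq p & 3 <= size p] ->
  nth x (x :: p) i != nth x (x :: p) i.+2.
Proof.
move=> lti /orP[u|/and3P[/eqP cl u L3]].
  by rewrite nth_uniq //=; lia.
case: i lti => [|i] lti; last by rewrite /= nth_uniq //; lia.
rewrite -[X in X != _]cl -(nth_last x) /= nth_uniq //; lia.
Qed.

Lemma thread_arc (T : finType) (e : rel T) (w : walk T) :
  is_thread e w -> is_arc e (vtx w) (len w).
Proof.
move=> /and5P[L0 op hb lb /allP inn].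
have pth : path e w.1 w.2 by case/orP: op => [/andP[]|/and4P[]].
split=> //.
- by move=> i lti; apply: (pathP (first w) pth).
- by move=> i lti; apply/eqP/inn/innerP; exists i.
- move=> i lti; apply: path_turn => //.
  by case/orP: op => [/andP[_ ->]//|/and4P[_ cl u L3]]; apply/orP; right; apply/and3P.
- by rewrite vtx_final.
Qed.

Section Arcs.
Variables (T : finType) (e : rel T).
Hypothesis e_sym : symmetric e.

Lemma nbr_deg2 (v a b z : T) : deg e v = 2 -> a != b -> e v a -> e v b ->
  e v z -> z = a \/ z = b.
Proof.
move=> dv ab va vb vz.
have /eqP E : [set a; b] == [set y | e v y].
  by rewrite eqEcard -/(deg e v) dv cards2 ab andbT; apply/subsetP => y;
    rewrite !inE => /orP[]/eqP->.
have : z \in [set a; b] by rewrite E inE.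
by rewrite !inE => /orP[]/eqP; [left|right].
Qed.

Lemma arc_nbr x L i z : is_arc e x L -> 0 < i < L -> e (x i) z ->
  z = x i.-1 \/ z = x i.+1.
Proof.
move=> ax iL; apply: nbr_deg2; first exact: arc_deg ax _ iL.
- by case: i iL => // i iL; apply: (arc_turn ax); lia.
- by case: i iL => // i iL; rewrite e_sym; apply: (arc_edge ax); lia.
- by apply: (arc_edge ax); lia.
Qed.

Lemma deg2_branch v : deg e v = 2 -> ~~ is_branch e v.
Proof. by rewrite /is_branch => ->. Qed.

Lemma arc_rev x L : is_arc e x L -> is_arc e (fun i => x (L - i)) L.
Proof.
move=> ax; split; rewrite ?subn0 ?subnn.
- exact: arc_gt0 ax.
- move=> i iL; rewrite e_sym; have -> : L - i = (L - i.+1).+1 by lia.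
  by apply: (arc_edge ax); lia.
- by move=> i iL; apply: (arc_deg ax); lia.
- move=> i iL; rewrite eq_sym.
  have -> : L - i = (L - i.+2).+2 by lia.
  by apply: (arc_turn ax); lia.
- exact: arc_last ax.
- exact: arc_head ax.
Qed.

(** At an inner vertex the walk has no choice but to leave by the other edge, and
    it must stop at the first branch vertex: a thread is determined by its first
    step. *)
Lemma arc_det x L y M : is_arc e x L -> is_arc e y M ->
  x 0 = y 0 -> x 1 = y 1 -> L = M /\ forall i, i <= L -> x i = y i.
Proof.
move=> ax ay xy0 xy1.
(* Two consecutive equal vertices fix the next one. *)
have step i : i < L -> i < M -> x i = y i /\ x i.+1 = y i.+1.
  elim: i => // i IH iL iM; have [E1 E2] := IH (ltnW iL) (ltnW iM).
  split=> //.
  have /(arc_nbr ay) : 0 < i.+1 < M by lia.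
  move/(_ (x i.+2)); case=> //; first by rewrite -E2; apply: (arc_edge ax); lia.
  by rewrite /= -E1 => /esym /eqP; rewrite (negPf (arc_turn ax _)).
have le i : i <= L -> i <= M -> x i = y i.
  by case: i => // i iL iM; have [] := step i iL iM.
case: (ltngtP L M) => LM.
- have := deg2_branch (arc_deg ay (i := L) _); rewrite -le ?(ltnW LM) //.
  by rewrite (arc_last ax) LM (arc_gt0 ax) => /(_ isT).
- have := deg2_branch (arc_deg ax (i := M) _); rewrite le ?(ltnW LM) //.
  by rewrite (arc_last ay) LM (arc_gt0 ay) => /(_ isT).
- by split=> // i iL; apply: le; rewrite -?LM.
Qed.

(** The part of [arc_share] that follows the thread forwards; the rest is the same
    statement for the reversed thread. *)
Lemma arc_share_up x L y M i j : is_arc e x L -> is_arc e y M ->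
  0 < i < L -> 0 < j < M -> x i = y j ->
  forall k, i <= k < L -> exists2 j', 0 < j' < M & x k = y j'.
Proof.
move=> ax ay iL jM xy; elim=> [|k IH] kL; first by lia.
have [<-|ik] := eqVneq i k.+1; first by exists j.
have [|j' jM' E] := IH _; first by lia.
have ekk : e (y j') (x k.+1) by rewrite -E; apply: (arc_edge ax); lia.
have nb := deg2_branch (arc_deg ax (i := k.+1) _).
have {}nb : ~~ is_branch e (x k.+1) by apply: nb; lia.
have [Ek|Ek] := arc_nbr ay jM' ekk; rewrite Ek in nb *.
- exists j'.-1 => //; case: j' jM' {E ekk Ek} nb => // -[|j'] jM' nb; last by lia.
  by rewrite (arc_head ay) in nb.
- exists j'.+1 => //; have [E2|] := eqVneq j'.+1 M; last by lia.
  by rewrite E2 (arc_last ay) in nb.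
Qed.

(** The inner vertices of a thread form a connected component of the subgraph
    induced on the vertices of degree two, so two threads that meet in an inner
    vertex have the same inner vertices. *)
Lemma arc_share x L y M i j : is_arc e x L -> is_arc e y M ->
  0 < i < L -> 0 < j < M -> x i = y j ->
  forall k, 0 < k < L -> exists2 j', 0 < j' < M & x k = y j'.
Proof.
move=> ax ay iL jM xy k kL.
have [ik|ki] := leqP i k; first by apply: (arc_share_up ax ay iL jM xy); lia.
have [j' jM' E] : exists2 j', 0 < j' < M & x (L - (L - k)) = y j'.
  apply: (arc_share_up (arc_rev ax) ay (i := L - i) _ jM); try lia.
  by rewrite subKn //; lia.
by exists j' => //; rewrite -E subKn //; lia.
Qed.

Lemma arc_nbr_branch x L i z : is_arc e x L -> 0 < i < L -> e (x i) z ->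
  is_branch e z -> z = x 0 \/ z = x L.
Proof.
move=> ax iL /(arc_nbr ax iL) E bz.
have nb k : x k = z -> ~~ (0 < k < L).
  by move=> xk; apply/negP => /(arc_deg ax)/deg2_branch; rewrite xk bz.
case: E => E; have i0 := nb _ (esym E); [left|right].
- by rewrite E; congr x; lia.
- by rewrite E; congr x; lia.
Qed.
End Arcs.

(** * Ordinary threads with a common inner vertex *)

Lemma edgesP (T : finType) (w : walk T) (E : {set T}) :
  reflect (exists2 i, i < len w & E = [set vtx w i; vtx w i.+1]) (E \in edges w).
Proof.
rewrite inE; apply: (iffP (nthP set0)) => -[i]; rewrite ?size_pairmap => lti.
  by rewrite (nth_pairmap (first w)) // => <-; exists i.
by move=> ->; exists i; rewrite ?size_pairmap // (nth_pairmap (first w)).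
Qed.

Section Threads.
Variables (T : finType) (e : rel T).
Hypothesis e_sym : symmetric e.

Lemma othread_arc (h : othread e) : is_arc e (vtx (val h)) (olen h).
Proof. by apply: thread_arc; case/andP: (valP h). Qed.

Lemma ordinary_final_neq (h : othread e) : first (val h) != final (val h).
Proof. by case/andP: (valP h). Qed.

Lemma othread_uniq (h : othread e) : uniq ((val h).1 :: (val h).2).
Proof.
case/andP: (valP h) => /and5P[_ op _ _ _] ne.
by case/orP: op => [/andP[]//|/and4P[_ /eqP cl]]; rewrite cl eqxx in ne.
Qed.

Lemma othread_inj (h : othread e) i j : i <= olen h -> j <= olen h ->
  vtx (val h) i = vtx (val h) j -> i = j.
Proof.
by move=> iL jL /eqP; rewrite /vtx nth_uniq ?othread_uniq //= ?ltnS // => /eqP.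
Qed.

Lemma othread_first_edge (h : othread e) : e (first (val h)) (vtx (val h) 1).
Proof. exact: (arc_edge (othread_arc h) (arc_gt0 (othread_arc h))). Qed.

Lemma othread_last_edge (h : othread e) :
  e (vtx (val h) (olen h).-1) (final (val h)).
Proof.
have L0 := arc_gt0 (othread_arc h).
have -> : final (val h) = vtx (val h) (olen h).-1.+1 by rewrite prednK // -vtx_final.
by apply: (arc_edge (othread_arc h)); rewrite prednK.
Qed.

(** Two threads of length at least two share an inner vertex exactly when they are
    the same thread up to direction. *)
Definition share (g h : othread e) : Prop :=
  exists i j, [/\ 0 < i < olen g, 0 < j < olen h & vtx (val g) i = vtx (val h) j].

Lemma share_sym g h : share g h -> share h g.
Proof. by move=> [i [j [iL jL E]]]; exists j, i. Qed.

(** Each edge of a thread with an inner vertex has an inner end, and the edges at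
    an inner vertex belong to every thread through it. *)
Lemma share_edges g h : share g h -> edges (val g) \subset edges (val h).
Proof.
move=> [i [j [iL jL E]]]; apply/subsetP => S /edgesP[k kL ->]; apply/edgesP.
have sub := arc_share e_sym (othread_arc g) (othread_arc h) iL jL E.
have eg := arc_edge (othread_arc g) kL.
have use k' z : 0 < k' < olen g -> e (vtx (val g) k') z ->
    exists2 l, l < olen h & [set vtx (val g) k'; z] = [set vtx (val h) l; vtx (val h) l.+1].
  move=> /sub[l lL ->] /(arc_nbr e_sym (othread_arc h) lL)[]->.
    by exists l.-1; rewrite ?prednK 1?setUC //; lia.
  by exists l; rewrite //; lia.
have [k0|k0] := posnP k; last by apply: use => //; rewrite -/(olen g) in kL; lia.
by rewrite setUC; apply: use; [lia | rewrite e_sym].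
Qed.

Lemma share_same_thread g h : share g h -> same_thread g h.
Proof.
move=> gh; rewrite /same_thread eqEsubset share_edges //=.
exact/share_edges/share_sym.
Qed.

Lemma share_olen g h : share g h -> olen g <= olen h.
Proof.
move=> [i [j [iL jL E]]].
have sub := arc_share e_sym (othread_arc g) (othread_arc h) iL jL E.
pose s (f : othread e) := [seq vtx (val f) k | k <- iota 1 (olen f).-1].
have us : uniq (s g).
  rewrite map_inj_in_uniq ?iota_uniq // => a b; rewrite !mem_iota => aL bL.
  by apply: othread_inj; lia.
suff : size (s g) <= size (s h) by rewrite !size_map !size_iota; lia.
apply: uniq_leq_size => // v /mapP[k]; rewrite mem_iota => kL ->.
have [|l lL ->] := sub k; first by lia.
by apply/mapP; exists l; rewrite ?mem_iota //; lia.
Qed.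

Lemma share_first g h : share g h ->
  first (val g) = first (val h) \/ first (val g) = final (val h).
Proof.
move=> [i [j [iL jL E]]].
have [l lL El] := arc_share e_sym (othread_arc g) (othread_arc h) iL jL E (k := 1) ltac:(lia).
rewrite -!vtx_first -vtx_final; apply: (arc_nbr_branch e_sym (othread_arc h) lL).
  by rewrite -El e_sym; apply: (arc_edge (othread_arc g)); lia.
exact: arc_head (othread_arc g).
Qed.

Lemma share_final g h : share g h ->
  final (val g) = first (val h) \/ final (val g) = final (val h).
Proof.
move=> [i [j [iL jL E]]].
have [l lL El] := arc_share e_sym (othread_arc g) (othread_arc h) iL jL E
  (k := (olen g).-1) ltac:(lia).
rewrite -vtx_first -(vtx_final (val h)); apply: (arc_nbr_branch e_sym (othread_arc h) lL).
  by rewrite -El; apply: othread_last_edge.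
exact: final_branch.
Qed.

End Threads.

(** * The expanded core *)

Section Core.
Variables (T : finType) (e : rel T).
Hypothesis e_sym : symmetric e.

Definition is_core (v : T) := ~~ [exists w : walk T, is_loop e w && (v \in inner w)].

Lemma loop_arc w : is_loop e w -> is_arc e (vtx w) (len w).
Proof. by case/andP => /thread_arc. Qed.

Lemma branch_core v : is_branch e v -> is_core v.
Proof.
move=> bv; apply/existsPn => w; apply/negP => /andP[/loop_arc aw /innerP[i iL vE]].
by have := deg2_branch (arc_deg aw iL); rewrite -vE bv.
Qed.

Lemma loop_root w i z : is_loop e w -> 0 < i < len w -> e (vtx w i) z ->
  is_branch e z -> z = first w.
Proof.
move=> lw iL ez bz; case/andP: (lw) => _ /eqP cl.
by have [] := arc_nbr_branch e_sym (loop_arc lw) iL ez bz; rewrite ?vtx_first ?vtx_final -?cl.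
Qed.

(** Were the vertex inner to a loop thread too, both ends of the ordinary thread
    would be the root of the loop. *)
Lemma inner_core (g : othread e) i : 0 < i < olen g -> is_core (vtx (val g) i).
Proof.
move=> iL; apply/existsPn => w; apply/negP => /andP[lw /innerP[j jL E]].
have aw := loop_arc lw; have ag := othread_arc g.
have sub := arc_share e_sym ag aw iL jL E.
have [l lL El] := sub 1 ltac:(lia).
have [l' lL' El'] := sub (olen g).-1 ltac:(lia).
case/negP: (ordinary_final_neq g); apply/eqP; transitivity (first w).
  apply: (loop_root lw lL); last exact: first_branch.
  by rewrite -El e_sym; apply: othread_first_edge.
apply/esym; apply: (loop_root lw lL'); last exact: final_branch.
by rewrite -El'; apply: othread_last_edge.
Qed.

Lemma othread_core (g : othread e) i : i <= olen g -> is_core (vtx (val g) i).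
Proof.
move=> iL; case: (posnP i) => [->|i0]; first exact/branch_core/(arc_head (othread_arc g)).
have [->|iL'] := eqVneq i (olen g); first exact/branch_core/(arc_last (othread_arc g)).
by apply: inner_core; lia.
Qed.

Lemma loop_len w : is_loop e w -> 2 < len w.
Proof.
case/andP => /and5P[L0 op _ _ _] /eqP cl; case/orP: op => [/andP[_ /= /andP[u _]]|/and4P[]//].
case: w L0 u cl => x [[|y p] szp] //=; rewrite /first /final /= => _ u xE.
by rewrite {1}xE mem_last in u.
Qed.

Lemma loop_edge_inner w a b : is_loop e w -> [set a; b] \in edges w ->
  (a \in inner w) || (b \in inner w).
Proof.
move=> lw /edgesP[i iL E]; have L3 := loop_len lw.
have [k kL kE] : exists2 k, 0 < k < len w & vtx w k \in [set a; b].
  case: (posnP i) => i0; [exists i.+1|exists i]; rewrite ?E ?inE ?eqxx ?orbT //; lia.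
have inn : vtx w k \in inner w by apply/innerP; exists k.
by move: kE; rewrite !inE => /orP[]/eqP <-; rewrite inn ?orbT.
Qed.

(** Connectivity of the core, in the form in which potentials use it.  A function
    on the core extends to the graph by giving the inner vertices of a loop the
    value at its root; the extension is constant along edges as well. *)
Lemma core_connected (R : Type) (f : core_vertex e -> R) :
  (forall x y, connect e x y) ->
  (forall x y, core_rel x y -> f x = f y) -> forall x y, f x = f y.
Proof.
move=> conn fE x y.
(* The third value is never taken: a vertex outside the core is inner to a loop. *)
pose F (v : T) := if insub v is Some c then f c else
  if [pick w | is_loop e w && (v \in inner w)] is Some w
  then f (insubd x (first w)) else f x.
have Fc (c : core_vertex e) : F (val c) = f c by rewrite /F valK.
have Fb v : is_branch e v -> F v = f (insubd x v).
  by move=> /branch_core cv; rewrite -Fc insubdK.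
have Fl w v : is_loop e w -> v \in inner w -> F v = F (first w).
  move=> lw vw.
  have bw : is_branch e (first w) by case/andP: lw => /and5P[].
  rewrite (Fb _ bw) /F insubF; last by apply/negbF/existsP; exists w; rewrite lw.
  case: pickP => [w' /andP[lw' vw']|/(_ w)]; last by rewrite lw vw.
  congr (f (insubd _ _)); case/innerP: vw => i iL E; case/innerP: vw' => j jL E'.
  have [||l lL El] := arc_share e_sym (loop_arc lw') (loop_arc lw) jL iL _ (k := 1).
  - by rewrite -E -E'.
  - by have := loop_len lw'; lia.
  apply: (loop_root lw lL); last by case/andP: lw' => /and5P[].
  by rewrite -El e_sym -vtx_first; apply: (arc_edge (loop_arc lw')); lia.
have step w a b : is_loop e w -> a \in inner w -> e a b -> F a = F b.
  move=> lw aw eab; rewrite (Fl w) //; case/innerP: (aw) => i iL aE.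
  rewrite aE in eab.
  have [bb|nb] := boolP (is_branch e b); first by rewrite (loop_root lw iL eab).
  rewrite [RHS](Fl w) //; apply/innerP.
  have ew := loop_arc lw.
  have [E|E] := arc_nbr e_sym ew iL eab; rewrite E in nb *.
    exists i.-1 => //; case: i iL {E aE eab} nb => // -[|i] iL nb; last by lia.
    by rewrite (arc_head ew) in nb.
  exists i.+1 => //; have [E2|] := eqVneq i.+1 (len w); last by lia.
  by rewrite E2 (arc_last ew) in nb.
have FE a b : e a b -> F a = F b.
  move=> eab.
  have [/existsP[w /andP[lw aw]]|ca] :=
    boolP [exists w, is_loop e w && (a \in inner w)]; first exact: step lw aw eab.
  have [/existsP[w /andP[lw bw]]|cb] :=
    boolP [exists w, is_loop e w && (b \in inner w)].
    by apply/esym/(step w) => //; rewrite e_sym.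
  rewrite (Fc (Sub a ca)) (Fc (Sub b cb)); apply: fE; rewrite /core_rel /= eab /=.
  apply/existsPn => w; apply/negP => /andP[lw /(loop_edge_inner lw)/orP[] iw].
    by have /existsPn/(_ w) := ca; rewrite lw iw.
  by have /existsPn/(_ w) := cb; rewrite lw iw.
rewrite -!Fc; have /connectP[p pth ->] := conn (val x) (val y).
by elim: p (val x) pth => //= z p IH a /andP[/FE-> /IH].
Qed.

End Core.

(** * Threads leaving a branch vertex *)

Lemma size_rev_belast (T : finType) (w : walk T) :
  size (rev (belast w.1 w.2)) <= #|T|.
Proof. by rewrite size_rev size_belast size_bseq. Qed.

Definition rev_walk (T : finType) (w : walk T) : walk T :=
  (final w, Bseq (size_rev_belast w)).

Section Reversal.
Variable T : finType.
Implicit Type w : walk T.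

Lemma rev_walkE w : (rev_walk w).1 :: (rev_walk w).2 = rev (w.1 :: w.2).
Proof. by rewrite [in RHS]lastI rev_rcons. Qed.

Lemma len_rev w : len (rev_walk w) = len w.
Proof. by rewrite /len /= size_rev size_belast. Qed.

Lemma vtx_rev w i : i <= len w -> vtx (rev_walk w) i = vtx w (len w - i).
Proof.
move=> iL; rewrite /vtx rev_walkE nth_rev //= subSS.
by apply: set_nth_default; rewrite /= ltnS leq_subr.
Qed.

Lemma final_rev w : final (rev_walk w) = first w.
Proof. by rewrite -vtx_final len_rev vtx_rev // subnn. Qed.

Variable e : rel T.
Hypothesis e_sym : symmetric e.

Lemma rev_ordinary w : is_ordinary e w -> is_ordinary e (rev_walk w).
Proof.
case/andP=> th ne; have /and5P[L0 op bf bl inn] := th.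
apply/andP; split; last by rewrite final_rev eq_sym.
apply/and5P; split; rewrite ?len_rev ?final_rev //.
  case/orP: op => [/andP[pth u]|/and4P[_ /eqP cl]]; last by rewrite cl eqxx in ne.
  apply/orP; left; apply/andP; split; last by rewrite rev_walkE rev_uniq.
  by rewrite rev_path (eq_path (e' := e)).
apply/allP => v /innerP[i]; rewrite len_rev => iL ->.
rewrite vtx_rev; last by lia.
by apply: (allP inn); apply/innerP; exists (len w - i) => //; lia.
Qed.

Definition rev_othread (h : othread e) : othread e :=
  exist _ (rev_walk (val h)) (rev_ordinary (valP h)).

End Reversal.

Section Orientation.
Variables (T : finType) (e : rel T).
Hypothesis e_sym : symmetric e.

Lemma othread_eq (f f' : othread e) : olen f = olen f' ->
  (forall i, i <= olen f -> vtx (val f) i = vtx (val f') i) -> f = f'.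
Proof.
case: f => [[x [p sp]] hp]; case: f' => [[x' [p' sp']] hp'].
rewrite /olen /len /vtx /first /= => szE E.
have xE := E 0 (leq0n _); rewrite /= in xE; subst x'.
have pE : p = p'.
  apply: (eq_from_nth (x0 := x)) => // i ip; exact: E i.+1 ip.
subst p'; rewrite (bool_irrelevance sp' sp) in hp' *.
by rewrite (bool_irrelevance hp' hp).
Qed.

Definition endpoint (f : othread e) (z : T) : bool :=
  (first (val f) == z) || (final (val f) == z).

(** The thread traversed so as to start at its end z. *)
Definition walk_from (f : othread e) (z : T) (i : nat) : T :=
  if first (val f) == z then vtx (val f) i else vtx (val f) (olen f - i).

(** The choice of direction made by the edges of the branch network. *)
Definition oriented (f : othread e) : bool :=
  enum_rank (ofirst f) < enum_rank (ofinal f).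

Lemma walk_from_arc f z : is_arc e (walk_from f z) (olen f).
Proof.
rewrite /walk_from; case: (_ == z); first exact: othread_arc.
exact/arc_rev/othread_arc.
Qed.

Lemma walk_from0 f z : endpoint f z -> walk_from f z 0 = z.
Proof.
rewrite /walk_from /endpoint; case: eqP => [<-//|_ /= /eqP <-].
by rewrite subn0 -vtx_final.
Qed.

Lemma walk_from_nbr f z : endpoint f z -> e z (walk_from f z 1).
Proof.
move=> fz; have := arc_edge (walk_from_arc f z) (arc_gt0 (walk_from_arc f z)).
by rewrite walk_from0.
Qed.

Lemma walk_from_unit f u v : endpoint f u -> endpoint f v -> u != v ->
  olen f = 1 -> walk_from f u 1 = v.
Proof.
move=> fu fv uv f1; rewrite /walk_from f1 subnn; case: eqP => [fE|fE].
  have -> : vtx (val f) 1 = final (val f) by rewrite -vtx_final -/(olen f) f1.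
  by move: fv; rewrite /endpoint fE (negPf uv) => /eqP.
move: fv fu; rewrite /endpoint vtx_first => /orP[/eqP->//|/eqP->].
by rewrite (eq_sym v) (negPf uv) orbF => /eqP.
Qed.

(** Different edges of the branch network leave z by different edges of the
    graph: [arc_det] identifies the threads up to direction, and the orientation
    settles the direction. *)
Lemma walk_from_inj f f' z : oriented f -> oriented f' ->
  endpoint f z -> endpoint f' z -> walk_from f z 1 = walk_from f' z 1 -> f = f'.
Proof.
move=> of1 of2 fz fz' E1.
have E0 : walk_from f z 0 = walk_from f' z 0 by rewrite !walk_from0.
have [LE E] := arc_det e_sym (walk_from_arc f z) (walk_from_arc f' z) E0 E1.
move: of1 of2 E fz fz'; rewrite /oriented /walk_from /endpoint.
case: eqP => [<-|fN]; case: eqP => [fE|fE] of1 of2 E fz fz'.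
- exact: othread_eq.
- have ff : ofinal f = ofirst f'.
    by apply: val_inj; rewrite /= -vtx_final -/(olen f) E // LE subnn.
  have fl : ofinal f' = ofirst f by apply: val_inj; rewrite /= (eqP fz').
  by move: (ltn_trans of1 (etrans (congr1 (fun z => enum_rank z < _) ff) of2)); rewrite fl ltnn.
- have ff : ofinal f' = ofirst f.
    by apply: val_inj; rewrite /= -vtx_final -/(olen f') -LE -E // subnn.
  have fl : ofinal f = ofirst f' by apply: val_inj; rewrite /= (eqP fz) fE.
  by move: (ltn_trans of1 (etrans (congr1 (fun z => enum_rank z < _) fl) of2)); rewrite ff ltnn.
- apply: othread_eq => // i iL; have := E (olen f - i) (leq_subr _ _).
  by rewrite -LE subKn.
Qed.

Lemma card_endpoint z : #|[pred f | oriented f & endpoint f z]| <= deg e z.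
Proof.
rewrite -(card_in_imset (f := fun f => walk_from f z 1)).
  apply/subset_leq_card/subsetP => y /imsetP[f /andP[_ fz] ->].
  by rewrite inE walk_from_nbr.
move=> f f' /andP[of1 fz] /andP[of2 fz'].
exact: walk_from_inj.
Qed.

Lemma oriented_rep (h : othread e) : exists f : othread e,
  [/\ oriented f, olen f = olen h,
      endpoint f (first (val h)) & endpoint f (final (val h))].
Proof.
have ne : ofirst h != ofinal h.
  by apply: contra (ordinary_final_neq h) => /eqP E; apply/eqP; case: E.
have [lt|gt|/ord_inj/enum_rank_inj E] := ltngtP (enum_rank (ofirst h)) (enum_rank (ofinal h)).
- by exists h; split; rewrite // /endpoint eqxx ?orbT.
- exists (rev_othread e_sym h); rewrite /endpoint /= ?final_rev ?eqxx ?orbT.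
  split=> //; last by rewrite /olen /= len_rev.
  have E1 : ofirst (rev_othread e_sym h) = ofinal h by apply: val_inj.
  have E2 : ofinal (rev_othread e_sym h) = ofirst h.
    by apply: val_inj; rewrite /= final_rev.
  by rewrite /oriented E1 E2.
- by rewrite E eqxx in ne.
Qed.
End Orientation.

Local Open Scope ring_scope.

(** * Dirichlet's principle *)

Definition energy (R : realFieldType) (V : finType) (N : network R V)
    (phi : V -> R) : R :=
  \sum_(g : edge N) (phi (src g) - phi (tgt g)) ^+ 2 / res g.

Definition potential_row (R : realFieldType) (V : finType) (phi : V -> R) :
  'rV[R]_#|V| := \row_i phi (enum_val i).

Lemma potential_row_dipole (R : realFieldType) (V : finType) (phi : V -> R) x y :
  (potential_row phi *m (dipole R x y)^T) 0 0 = phi x - phi y.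
Proof. by rewrite mul_dipole !mxE !enum_rankK. Qed.

Lemma row_dot_sym (R : realFieldType) (n : nat) (u w : 'rV[R]_n) :
  (u *m w^T) 0 0 = (w *m u^T) 0 0.
Proof. by rewrite -[w in RHS]trmxK -trmx_mul [RHS]mxE. Qed.

Lemma laplacian_form (R : realFieldType) (V : finType) (N : network R V)
    (u w : 'rV[R]_#|V|) :
  (u *m laplacian N *m w^T) 0 0 =
  \sum_(g : edge N) (u *m (dipole R (src g) (tgt g))^T) 0 0
     * (w *m (dipole R (src g) (tgt g))^T) 0 0 / res g.
Proof.
rewrite /laplacian mulmx_sumr mulmx_suml summxE; apply: eq_bigr => g _.
rewrite -scalemxAr -scalemxAl mxE mulrC; congr (_ / _).
rewrite (mulmxA u) -(mulmxA _ (dipole _ _ _)) mxE big_ord1; congr (_ * _).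
by rewrite row_dot_sym.
Qed.

Lemma laplacian_sym (R : realFieldType) (V : finType) (N : network R V) :
  (laplacian N)^T = laplacian N.
Proof.
rewrite /laplacian linear_sum /=; apply: eq_bigr => g _.
by rewrite linearZ /= trmx_mul trmxK.
Qed.

(** The laplacian is symmetric and positive semidefinite, so its kernel consists
    of the potentials of zero energy; a dipole on which they all vanish lies in
    its row space. *)
Lemma dipole_sub_laplacian (R : realFieldType) (V : finType) (N : network R V)
    (x y : V) :
  (forall f : V -> R, (forall g : edge N, f (src g) = f (tgt g)) -> f x = f y) ->
  (dipole R x y <= laplacian N)%MS.
Proof.
move=> Hxy; rewrite submxE; apply/eqP/rowP => j.
pose c := (col j (cokermx (laplacian N)))^T.
have Lc : c *m laplacian N = 0.
  apply: (can_inj (@trmxK _ _ _)); rewrite trmx_mul laplacian_sym /c trmxK trmx0.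
  by rewrite colE mulmxA mulmx_coker mul0mx.
pose f v := c 0 (enum_rank v).
have cE : c = potential_row f.
  by apply/rowP => i; rewrite [RHS]mxE /f enum_valK.
have /eqP := laplacian_form N c c; rewrite Lc mul0mx mxE eq_sym psumr_eq0; last first.
  by move=> g _; rewrite divr_ge0 ?(ltW (res_gt0 g)) // -expr2 sqr_ge0.
move/allP => z.
have {}z (g : edge N) : f (src g) = f (tgt g).
  have := z g (mem_index_enum _).
  rewrite /= !mulf_eq0 invr_eq0 (gt_eqF (res_gt0 g)) orbF orbb.
  by rewrite cE potential_row_dipole subr_eq0 => /eqP.
have /eqP := Hxy f z; rewrite -subr_eq0 -(potential_row_dipole f) -cE row_dot_sym /c trmxK.
by rewrite colE mulmxA -colE !mxE => /eqP.
Qed.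

(** Dirichlet's principle: with dipole = u L, where L is the laplacian, the
    resistance is u L u^T and the potential drop is u L phi^T, so the inequality
    is that of Cauchy and Schwarz for the form L.  The hypothesis on functions
    constant along edges says that x and y are connected. *)
Lemma eff_res_ge (R : realFieldType) (V : finType) (N : network R V)
    (x y : V) (phi : V -> R) :
  (forall f : V -> R, (forall g : edge N, f (src g) = f (tgt g)) -> f x = f y) ->
  (phi x - phi y) ^+ 2 <= eff_res N x y * energy N phi.
Proof.
move=> /dipole_sub_laplacian sub.
have [/= u du] := submxP sub.
have -> : eff_res N x y = energy N (fun v => u 0 (enum_rank v)).
  rewrite /eff_res {2}du trmx_mul laplacian_sym mulmxA mulmxKpV // du laplacian_form.
  apply: eq_bigr => g _; rewrite -expr2; congr (_ ^+ 2 / _).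
  by rewrite mul_dipole.
have -> : phi x - phi y = \sum_(g : edge N)
    (u 0 (enum_rank (src g)) - u 0 (enum_rank (tgt g)))
    * (phi (src g) - phi (tgt g)) / res g.
  rewrite -potential_row_dipole row_dot_sym du laplacian_form.
  by apply: eq_bigr => g _; rewrite mul_dipole potential_row_dipole.
set U := energy N _; set P := energy N phi; set S := \sum_g _.
have key (a b : R) : 0 <= a ^+ 2 * U - 2 * (a * b) * S + b ^+ 2 * P.
  have -> : a ^+ 2 * U - 2 * (a * b) * S + b ^+ 2 * P = \sum_(g : edge N)
      (a * (u 0 (enum_rank (src g)) - u 0 (enum_rank (tgt g)))
       - b * (phi (src g) - phi (tgt g))) ^+ 2 / res g.
    rewrite /U /P /S /energy !mulr_sumr -sumrB -big_split /=.
    by apply: eq_bigr => g _; ring.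
  by apply: sumr_ge0 => g _; rewrite divr_ge0 ?sqr_ge0 // ltW ?res_gt0.
have U0 : 0 <= U by have := key 1 0; rewrite expr1n expr0n /=; nra.
(* The discriminant argument divides by P. *)
have [P0|P0] := eqVneq P 0.
  (* a potential of zero energy: S must vanish *)
  have [->|S0] := eqVneq S 0; first by rewrite P0 mulr0 expr0n.
  have := key 1 ((U + 1) / (2 * S) ); rewrite P0.
  have -> : 2 * (1 * ((U + 1) / (2 * S))) * S = U + 1 by field.
  by rewrite expr1n mul1r mulr0; lra.
have Pge : 0 <= P by have := key 0 1; rewrite expr1n expr0n /=; nra.
have Pgt : 0 < P by rewrite lt_neqAle eq_sym P0.
have := key P S.
have -> : P ^+ 2 * U - 2 * (P * S) * S + S ^+ 2 * P = P * (U * P - S ^+ 2) by ring.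
by rewrite pmulr_rge0 // subr_ge0.
Qed.

(** * Potentials on the expanded core *)

Lemma sum_sig (R : nmodType) (I : finType) (P : pred I) (F : I -> R) :
  \sum_(p : {p | P p}) F (val p) = \sum_(p | P p) F p.
Proof.
rewrite [RHS](reindex_omap (val : {p | P p} -> I) insub) => [|p Pp]; last by rewrite insubT.
by apply: eq_bigl => p; rewrite (valP p) valK eqxx.
Qed.

Lemma core_diam_ge0 (R : realFieldType) (T : finType) (e : rel T) :
  0 <= core_diam R e.
Proof.
by rewrite /core_diam; elim/big_rec: _ => // a d _ d0; rewrite le_max d0 orbT.
Qed.

Section CoreDiameter.
Variables (R : realFieldType) (T : finType) (e : rel T).
Hypothesis e_sym : symmetric e.

Definition lapl (phi : T -> R) (v : T) : R := \sum_(w | e v w) (phi v - phi w).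

Lemma laplE phi v : lapl phi v = (deg e v)%:R * phi v - \sum_(w | e v w) phi w.
Proof.
rewrite /lapl sumrB sumr_const mulr_natl; congr (_ *+ _ - _).
by rewrite /deg; apply: eq_card => w; rewrite inE.
Qed.

(** Summation by parts; a potential that is harmonic at most vertices of its
    support then has an energy with very few terms. *)
Lemma dirichlet_form phi :
  \sum_v \sum_(w | e v w) (phi v - phi w) ^+ 2 = 2 * \sum_v phi v * lapl phi v.
Proof.
have E : \sum_v phi v * lapl phi v = \sum_v \sum_(w | e v w) phi v * (phi v - phi w).
  by apply: eq_bigr => v _; rewrite mulr_sumr.
have E' : \sum_v phi v * lapl phi v = \sum_v \sum_(w | e v w) phi w * (phi w - phi v).
  rewrite E (exchange_big_dep predT) //=; apply: eq_bigr => v _.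
  by apply: eq_bigl => w; rewrite e_sym.
rewrite mulr_natl mulr2n {1}E E' -big_split /=; apply: eq_bigr => v _.
by rewrite -big_split /=; apply: eq_bigr => w _; ring.
Qed.

(** Deleting edges lowers the energy, so a potential on the core may be evaluated
    in the whole graph. *)
Lemma core_energy_le (phi : T -> R) :
  energy (unit_network R (@core_rel T e)) (fun v => phi (val v))
  <= \sum_v phi v * lapl phi v.
Proof.
set E := energy _ _.
pose D (p : core_vertex e * core_vertex e) := (phi (val p.1) - phi (val p.2)) ^+ 2.
have E1 : E = \sum_(p | core_rel p.1 p.2 && (enum_rank p.1 < enum_rank p.2)%N) D p.
  by rewrite -sum_sig; apply: eq_bigr => p _; rewrite divr1.
have E2 : E = \sum_(p | core_rel p.1 p.2 && (enum_rank p.2 < enum_rank p.1)%N) D p.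
  rewrite E1 (reindex_inj (can_inj (@swap_pairK _ _))) /=.
  apply: eq_big => [] [x y] /=; last by rewrite /D /= -opprB sqrrN.
  by rewrite /core_rel e_sym setUC.
rewrite -(ler_pM2l (x := 2)) // -dirichlet_form mulr_natl mulr2n {1}E1 E2.
apply: (@le_trans _ _ (\sum_(p | e (val p.1) (val p.2)) D p)).
  rewrite big_mkcond [X in _ + X]big_mkcond -big_split [leRHS]big_mkcond /=.
  apply: ler_sum => -[x y] _ /=; have D0 : 0 <= D (x, y) by apply: sqr_ge0.
  have [/andP[-> _]|_] := boolP (core_rel x y); last by rewrite addr0; case: ifP.
  by rewrite /=; case: ltngtP => _; rewrite ?addr0 ?add0r.
rewrite (eq_bigl (fun p => predT p.1 && e (val p.1) (val p.2))) //.
rewrite -(pair_big_dep predT (fun x y => e (val x) (val y)) (fun x y => D (x, y))) /=.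
rewrite /D /= (sum_sig _ (fun v =>
  \sum_(y : core_vertex e | e v (val y)) (phi v - phi (val y)) ^+ 2)).
rewrite big_mkcond; apply: ler_sum => v _; case: ifP => _; last first.
  by apply: sumr_ge0 => w _; apply: sqr_ge0.
rewrite big_mkcond (sum_sig _ (fun w => if e v w then (phi v - phi w) ^+ 2 else 0)).
rewrite -big_mkcondr big_mkcond [leRHS]big_mkcond; apply: ler_sum => w _.
by case: (e v w); rewrite ?andbF // andbT; case: ifP => // _; apply: sqr_ge0.
Qed.

Lemma core_diam_ge (x y : T) (phi : T -> R) :
  (forall a b, connect e a b) -> is_core e x -> is_core e y ->
  (phi x - phi y) ^+ 2 <= core_diam R e * \sum_v phi v * lapl phi v.
Proof.
move=> conn cx cy; pose x' : core_vertex e := Sub x cx; pose y' : core_vertex e := Sub y cy.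
have sub (f : core_vertex e -> R) :
    (forall g : edge (unit_network R (@core_rel T e)), f (src g) = f (tgt g)) -> f x' = f y'.
  move=> fE; apply: (core_connected e_sym conn) => a b ab.
  have [lt|lt|/ord_inj/enum_rank_inj->//] := ltngtP (enum_rank a) (enum_rank b).
    have abP : core_rel (a, b).1 (a, b).2 && (enum_rank (a, b).1 < enum_rank (a, b).2)%N.
      by rewrite /= ab.
    exact: (fE (exist _ (a, b) abP)).
  have baP : core_rel (b, a).1 (b, a).2 && (enum_rank (b, a).1 < enum_rank (b, a).2)%N.
    by rewrite /= lt andbT /core_rel e_sym setUC.
  exact/esym/(fE (exist _ (b, a) baP)).
have := eff_res_ge (fun v => phi (val v)) sub.
move/le_trans; apply.
have En0 : 0 <= energy (unit_network R (@core_rel T e)) (fun v => phi (val v)).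
  by apply: sumr_ge0 => g _; rewrite divr1 sqr_ge0.
have D0 := core_diam_ge0 R e.
apply: (@le_trans _ _ (core_diam R e *
    energy (unit_network R (@core_rel T e)) (fun v => phi (val v)))).
  apply: ler_wpM2r => //; rewrite /core_diam.
  apply: (le_trans _ (le_bigmax _ _ x')).
  exact: (le_bigmax _ (fun z => eff_res (unit_network R (@core_rel T e)) x' z) y').
by apply: ler_wpM2l => //; apply: core_energy_le.
Qed.
End CoreDiameter.

Lemma sum_pred1 (R : nmodType) (I : finType) (P : pred I) (a : I) (A : R) :
  \sum_(i | P i) (if i == a then A else 0) = if P a then A else 0.
Proof.
rewrite -big_mkcondr /=; case: ifP => Pa; last first.
  by apply: big_pred0 => i; apply/andP => -[Pi /eqP ia]; rewrite -ia Pi in Pa.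
by apply: (big_pred1 a) => i /=; have [->|_] := eqVneq i a; rewrite ?Pa ?andbF.
Qed.

Section Test.
Variables (R : realFieldType) (T : finType) (e : rel T).
Hypotheses (e_sym : symmetric e) (e_irr : irreflexive e).
Variable g : othread e.
Local Notation L := (olen g).
Local Notation x := (vtx (val g)).

Definition on_thread (v : T) : bool := v \in (val g).1 :: (val g).2.

Lemma on_threadP v : reflect (exists2 i, (i <= L)%N & v = x i) (on_thread v).
Proof.
apply: (iffP (nthP (first (val g)))) => [[i iL <-]|[i iL ->]]; exists i => //.
Qed.

Lemma on_thread_vtx i : (i <= L)%N -> on_thread (x i).
Proof. by move=> iL; apply/on_threadP; exists i. Qed.

Variables (f : nat -> R) (w : T) (eta : R).
Hypothesis w_off : ~~ on_thread w.
Hypothesis L2 : (1 < L)%N.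

(** Values f along the thread g, the value - eta at one vertex w off g, and zero
    elsewhere. *)
Definition test_potential (v : T) : R :=
  if on_thread v then f (index v ((val g).1 :: (val g).2))
  else if v == w then - eta else 0.
Local Notation phi := test_potential.

Lemma index_vtx i : (i <= L)%N -> index (x i) ((val g).1 :: (val g).2) = i.
Proof. by move=> iL; rewrite /vtx index_uniq ?othread_uniq //= ltnS. Qed.

Lemma test_vtx i : (i <= L)%N -> phi (x i) = f i.
Proof.
by move=> iL; rewrite /phi on_thread_vtx // index_vtx.
Qed.

Lemma test_off : phi w = - eta.
Proof. by rewrite /phi (negPf w_off) eqxx. Qed.

Let ag := othread_arc g.

Lemma vtx_neq i j : (i <= L)%N -> (j <= L)%N -> (x i == x j) = (i == j).
Proof. by move=> iL jL; apply/eqP/eqP => [/othread_inj->|->]. Qed.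

Lemma vtx_off i : (i <= L)%N -> (x i == w) = false.
Proof. by move=> iL; apply: contraNF w_off => /eqP <-; apply: on_thread_vtx. Qed.

Lemma sum_inner i (F : T -> R) : (0 < i < L)%N ->
  \sum_(y | e (x i) y) F y = F (x i.-1) + F (x i.+1).
Proof.
move=> iL; have e1 : e (x i) (x i.-1).
  by case: i iL => // i iL; rewrite e_sym; apply: (arc_edge ag); lia.
have e2 : e (x i) (x i.+1) by apply: (arc_edge ag); lia.
have ne : x i.+1 != x i.-1 by rewrite vtx_neq; lia.
rewrite (bigD1 _ e1) (bigD1 (x i.+1)) /= ?e2 ?ne // big_pred0 ?addr0 // => y.
apply/negbTE/negP => /andP[/andP[ey y1] y2].
by have [E|E] := arc_nbr e_sym ag iL ey; rewrite E eqxx in y1 y2.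
Qed.

Lemma lapl_inner i : (0 < i < L)%N ->
  lapl e phi (x i) = 2 * f i - f i.-1 - f i.+1.
Proof.
move=> iL; rewrite /lapl sum_inner // !test_vtx; [|lia..].
ring.
Qed.

Lemma inner_nbr_on i y : (0 < i < L)%N -> e (x i) y -> on_thread y.
Proof.
by move=> iL /(arc_nbr e_sym ag iL)[]->; apply: on_thread_vtx; lia.
Qed.

Lemma lapl_first : lapl e phi (x 0) =
  (deg e (x 0))%:R * f 0 - f 1 - (if e (x 0) (x L) then f L else 0)
  + (if e (x 0) w then eta else 0).
Proof.
rewrite laplE test_vtx //.
rewrite (eq_bigr (fun y => (if y == x 1 then f 1 else 0)
   + (if y == x L then f L else 0) + (if y == w then - eta else 0))).
  rewrite !big_split !sum_pred1 (arc_edge ag) ?(ltnW L2) //.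
  by move: (_%:R) (if _ then f L else 0) => d z; case: (e _ w); rewrite /=; ring.
move=> y ey; rewrite /phi; case: ifP => [/on_threadP[i iL E]|off].
  rewrite E vtx_off // !vtx_neq ?(ltnW L2) //; rewrite E in ey.
  have i0 : i != 0 by apply: contraTneq ey => ->; rewrite e_irr.
  rewrite index_vtx //.
  have [->|i1] := eqVneq i 1; first by rewrite ltn_eqF // !addr0.
  have [->|iL'] := eqVneq i L; first by rewrite add0r addr0.
  have iL2 : (0 < i < L)%N by lia.
  rewrite e_sym in ey.
  have [/eqP|/eqP] := arc_nbr e_sym ag iL2 ey; rewrite vtx_neq; lia.
have -> : (y == x 1) = false by apply: contraFF off => /eqP->; apply/on_thread_vtx/ltnW.
have -> : (y == x L) = false by apply: contraFF off => /eqP->; apply/on_thread_vtx.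
by rewrite !add0r.
Qed.

Lemma lapl_final : lapl e phi (x L) =
  (deg e (x L))%:R * f L - f L.-1 - (if e (x 0) (x L) then f 0 else 0)
  + (if e (x L) w then eta else 0).
Proof.
rewrite laplE test_vtx //.
have eL : e (x L) (x L.-1).
  by rewrite e_sym; have := othread_last_edge g; rewrite -vtx_final.
rewrite (eq_bigr (fun y => (if y == x L.-1 then f L.-1 else 0)
   + (if y == x 0 then f 0 else 0) + (if y == w then - eta else 0))).
  rewrite !big_split !sum_pred1 eL (e_sym (x 0)).
  by move: (_%:R) (if _ then f 0 else 0) => d z; case: (e _ w); rewrite /=; ring.
move=> y ey; rewrite /phi; case: ifP => [/on_threadP[i iL E]|off].
  rewrite E vtx_off // !vtx_neq ?leq_pred //; rewrite E in ey.
  have i0 : i != L by apply: contraTneq ey => ->; rewrite e_irr.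
  rewrite index_vtx //.
  have [->|i1] := eqVneq i L.-1.
    by have -> : (L.-1 == 0) = false by [lia]; rewrite !addr0.
  have [->|iL'] := eqVneq i 0; first by rewrite add0r addr0.
  have iL2 : (0 < i < L)%N by lia.
  rewrite e_sym in ey.
  have [/eqP|/eqP] := arc_nbr e_sym ag iL2 ey; rewrite vtx_neq; lia.
have -> : (y == x L.-1) = false.
  by apply: contraFF off => /eqP->; apply/on_thread_vtx/leq_pred.
have -> : (y == x 0) = false by apply: contraFF off => /eqP->; apply/on_thread_vtx.
by rewrite !add0r.
Qed.

Lemma lapl_off : lapl e phi w = - ((deg e w)%:R * eta)
  - (if e (x 0) w then f 0 else 0) - (if e (x L) w then f L else 0).
Proof.
rewrite laplE test_off.
rewrite (eq_bigr (fun y => (if y == x 0 then f 0 else 0)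
   + (if y == x L then f L else 0))).
  rewrite !big_split !sum_pred1 !(e_sym w) /=.
  by rewrite mulrN opprD addrA.
move=> y ey; rewrite /phi; case: ifP => [/on_threadP[i iL E]|off].
  rewrite E !vtx_neq //.
  rewrite index_vtx //.
  have [->|i0] := eqVneq i 0; first by rewrite ltn_eqF ?addr0 // ltnW.
  have [->|iL'] := eqVneq i L; first by rewrite add0r.
  have iL2 : (0 < i < L)%N by lia.
  case/negP: w_off; apply: (inner_nbr_on iL2); by rewrite -E e_sym.
have -> : (y == w) = false by apply: contraTF ey => /eqP->; rewrite e_irr.
have -> : (y == x 0) = false by apply: contraFF off => /eqP->; apply/on_thread_vtx.
have -> : (y == x L) = false by apply: contraFF off => /eqP->; apply/on_thread_vtx.
by rewrite addr0.
Qed.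

(** Only the peak m, the two ends and w contribute when f is harmonic at the other
    inner vertices (or vanishes there). *)
Lemma test_energy m : (0 < m < L)%N ->
  (forall i, (0 < i < L)%N -> i != m -> f i * (2 * f i - f i.-1 - f i.+1) = 0) ->
  \sum_v phi v * lapl e phi v =
    f m * (2 * f m - f m.-1 - f m.+1)
    + f 0 * lapl e phi (x 0) + f L * lapl e phi (x L) - eta * lapl e phi w.
Proof.
move=> mL harm.
rewrite (eq_bigr (fun v => (if v == x m then f m * (2 * f m - f m.-1 - f m.+1) else 0)
  + (if v == x 0 then f 0 * lapl e phi (x 0) else 0)
  + (if v == x L then f L * lapl e phi (x L) else 0)
  + (if v == w then - eta * lapl e phi w else 0))).
  by rewrite !big_split !sum_pred1 /= mulNr.
move=> v _; have [/on_threadP[i iL ->]|off] := boolP (on_thread v).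
  rewrite vtx_off // addr0 test_vtx // !vtx_neq //; last by lia.
  have [->|i0] := eqVneq i 0.
    have -> : (0 == m) = false by lia.
    have -> : (0 == L) = false by lia.
    by rewrite add0r addr0.
  have [->|iL'] := eqVneq i L.
    have -> : (L == m) = false by lia.
    by rewrite !add0r.
  rewrite lapl_inner ?addr0; last by lia.
  by have [->//|im] := eqVneq i m; apply: harm => //; lia.
have nx i : (i <= L)%N -> (v == x i) = false.
  by move=> iL; apply: contraNF off => /eqP->; apply: on_thread_vtx.
rewrite !nx ?addr0 ?add0r //; last by lia.
by have [->|vw] := eqVneq v w; rewrite ?test_off // /phi (negPf off) (negPf vw) mul0r.
Qed.
End Test.

(** * Lower bounds for the diameter of the core *)

Section Hat.
Variables (R : realFieldType) (L m : nat).
Hypothesis mL : (0 < m < L)%N.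

(** The potential of a unit current that enters at position m of a path of length L
    and leaves at both ends, which are at potential zero. *)
Definition hat (i : nat) : R :=
  if (i <= m)%N then i%:R * (L%:R - m%:R) / L%:R else (L%:R - i%:R) * m%:R / L%:R.

Let L0 : L%:R != 0 :> R. Proof. by rewrite pnatr_eq0; lia. Qed.

Lemma hat0 : hat 0 = 0. Proof. by rewrite /hat leq0n !mul0r. Qed.
Lemma hatL : hat L = 0.
Proof. by rewrite /hat leqNgt; case/andP: mL => _ ->; rewrite subrr !mul0r. Qed.

Lemma hat_peak : hat m = m%:R * (L%:R - m%:R) / L%:R.
Proof. by rewrite /hat leqnn. Qed.

Lemma hat_harmonic i : (0 < i)%N -> i != m -> 2 * hat i - hat i.-1 - hat i.+1 = 0.
Proof.
case: i => // i _ im; rewrite /hat /=.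
have [lt|ge] := ltnP i.+1 m.
  have -> : (i.+1 <= m)%N by lia.
  have -> : (i <= m)%N by lia.
  by rewrite -!natr1; field.
have -> : (i.+1 <= m)%N = false by lia.
have [im2|im2] := leqP i m; last by rewrite -!natr1; field.
by have -> : i = m by [lia]; rewrite -!natr1; field.
Qed.

Lemma hat_turn : 2 * hat m - hat m.-1 - hat m.+1 = 1.
Proof.
rewrite /hat leqnn leq_pred ltnn; case: m mL => //= k _.
by rewrite -!natr1; field.
Qed.

Lemma hat_slopes : hat 1 + hat L.-1 = 1.
Proof.
rewrite /hat; have -> : (1 <= m)%N by lia.
have Lk : L%:R = L.-1%:R + 1 :> R by rewrite natr1 prednK //; lia.
have := L0; rewrite Lk => l0.
have [h1|h1] := leqP L.-1 m; last by field.
by have -> : m = L.-1 by [lia]; field.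
Qed.
End Hat.

Section Diameter.
Variables (R : realFieldType) (T : finType) (e : rel T).
Hypotheses (e_sym : symmetric e) (e_irr : irreflexive e).
Hypothesis e_conn : forall a b, connect e a b.
Variable g : othread e.
Local Notation L := (olen g).
Local Notation x := (vtx (val g)).
Variable w : T.
Hypothesis w_off : ~~ on_thread g w.
Variable m : nat.
Hypothesis mL : (0 < m < L)%N.

Let L2 : (1 < L)%N. Proof. by lia. Qed.
Let lam : R := m%:R * (L%:R - m%:R) / L%:R.
Let lam0 : 0 < lam.
Proof.
case/andP: mL => m0 mL'; rewrite /lam divr_gt0 ?mulr_gt0 ?ltr0n ?subr_gt0 ?ltr_nat //.
by lia.
Qed.

(** A potential whose drop r is at least its energy shows D >= r. *)
Lemma core_diam_drop (f : nat -> R) (eta r : R) y : is_core e y -> 0 < r ->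
  let phi := test_potential g f w eta in
  phi (x m) - phi y = r -> \sum_v phi v * lapl e phi v <= r -> r <= core_diam R e.
Proof.
move=> cy r0 phi dphi En.
have cm : is_core e (x m) by apply: othread_core => //; lia.
have := core_diam_ge e_sym phi e_conn cm cy; rewrite dphi => H.
have D0 := core_diam_ge0 R e.
have : r * r <= core_diam R e * r by rewrite -expr2 (le_trans H) // ler_wpM2l.
by rewrite ler_pM2r.
Qed.

Lemma core_diam_hat0 : lam <= core_diam R e.
Proof.
have c0 : is_core e (x 0) by apply: othread_core.
apply: (core_diam_drop (f := hat R L m) (eta := 0) c0 lam0).
  by rewrite !test_vtx ?hat0 ?subr0 ?hat_peak //; lia.
rewrite (test_energy e_sym 0 w_off L2 mL) ?hat0 ?hatL // ?mul0r.
  by rewrite hat_turn // mulr1 !addr0 subr0 hat_peak.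
by move=> i iL im; rewrite hat_harmonic ?mulr0 //; lia.
Qed.

(** Unit current from the middle of g to its ends, then from the ends to w, as if
    all vertices off g other than w were merged with the ends. *)
Lemma core_diam_hat : is_core e w -> (0 < deg e w)%N ->
  lam + (deg e w)%:R^-1 <= core_diam R e.
Proof.
move=> cw dw; have d0 : 0 < (deg e w)%:R^-1 :> R by rewrite invr_gt0 ltr0n.
apply: (core_diam_drop (f := hat R L m) (eta := (deg e w)%:R^-1) cw).
- exact: addr_gt0.
- by rewrite test_vtx ?test_off ?hat_peak ?opprK //; lia.
rewrite (test_energy e_sym _ w_off L2 mL) ?hat0 ?hatL // ?mul0r.
  rewrite (lapl_off e_sym e_irr _ _ w_off L2) hat0 hatL // !if_same !subr0 hat_turn // hat_peak.
  by rewrite mulfV ?pnatr_eq0 -?lt0n // mulrN1 opprK !addr0 mulr1.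
by move=> i iL im; rewrite hat_harmonic ?mulr0 //; lia.
Qed.

(** Here the vertices off g are merged together.  When the ends are adjacent,
    deg u + deg v - 4 edges join them to the rest, and all carry the same current. *)
Lemma core_diam_cut : is_core e w -> e (x 0) (x L) ->
  (4 < deg e (x 0) + deg e (x L))%N ->
  lam + ((deg e (x 0) + deg e (x L))%:R - 4)^-1 <= core_diam R e.
Proof.
move=> cw direct n4; set n := (_ + _)%N in n4 *.
have n0 : 0 < n%:R - 4 :> R by rewrite subr_gt0 ltr_nat.
set c := (n%:R - 4)^-1; have c0 : 0 < c by rewrite invr_gt0.
(* Raising g by c sends the current c along each edge of the cut. *)
pose f i : R := c + hat R L m i.
apply: (core_diam_drop (f := f) (eta := 0) cw).
- exact: addr_gt0.
- rewrite test_vtx; last by lia.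
  by rewrite test_off // /f hat_peak oppr0 subr0 addrC.
rewrite (test_energy e_sym 0 w_off L2 mL) //; last first.
  move=> i iL im; rewrite /f; have := @hat_harmonic R L m mL i _ im.
  have -> : 2 * (c + hat R L m i) - (c + hat R L m i.-1) - (c + hat R L m i.+1)
    = 2 * hat R L m i - hat R L m i.-1 - hat R L m i.+1 by ring.
  by move=> ->; rewrite ?mulr0 //; lia.
rewrite (lapl_first e_sym e_irr _ _ w_off L2) (lapl_final e_sym e_irr _ _ w_off L2).
rewrite direct !if_same mul0r subr0 !addr0 /f hat0 hatL //.
have cn : ((deg e (x 0))%:R + (deg e (x L))%:R - 4) * c = 1.
  by rewrite /c /n natrD mulfV // -natrD gt_eqF.
have := @hat_turn R L m mL; have := @hat_slopes R L m mL; rewrite hat_peak -/lam.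
move: (hat R L m 1) (hat R L m L.-1) (hat R L m m.-1) (hat R L m m.+1) => h1 h2 h3 h4 s1 s2.
move: (deg e (x 0))%:R (deg e (x L))%:R cn => p q cn.
have -> : (c + lam) * (2 * (c + lam) - (c + h3) - (c + h4)) +
  (c + 0) * (p * (c + 0) - (c + h1) - (c + 0)) +
  (c + 0) * (q * (c + 0) - (c + h2) - (c + 0)) =
  (c + lam) * (2 * lam - h3 - h4) + c * ((p + q - 4) * c - (h1 + h2)) by ring.
by rewrite cn s1 s2; lra.
Qed.

(** The hat potential with its point mass, scaled to total drop 1, has energy 1;
    raising the value at u from 0 to 1/9 lowers the energy, since u receives 2/3 of
    the current from g and passes at most 1/3 on to w. *)
Lemma core_diam_tie : L = 3%N -> deg e (x 0) = 3%N -> is_core e w -> deg e w = 3%N ->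
  1 < core_diam R e.
Proof.
move=> L3 du cw dw.
pose f i : R := nth 0 [:: 1/9; 2/3; 1/3; 0] i.
have mL1 : (0 < 1 < L)%N by rewrite L3.
(* The drop 1 splits as 2/3 along g and 1/3 at w. *)
set phi := test_potential g f w (1/3).
have En : \sum_v phi v * lapl e phi v <= 26/27.
  rewrite (test_energy e_sym _ w_off L2 mL1) //; last first.
    by move=> i iL i1; have -> : i = 2 by [lia]; rewrite /f /=; lra.
  rewrite (lapl_first e_sym e_irr _ _ w_off L2) (lapl_off e_sym e_irr _ _ w_off L2).
  rewrite du dw L3 /f /= if_same mul0r.
  by case: (e _ w); case: (e _ w); lra.
have cm : is_core e (x 1) by apply: othread_core => //; lia.
have := core_diam_ge e_sym phi e_conn cm cw.
have -> : phi (x 1) - phi w = 1.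
  by rewrite /phi test_vtx ?test_off /f /= //; [lra|lia].
rewrite expr1n; have := core_diam_ge0 R e.
move: (core_diam R e) (\sum_v _) En => D E En D0 H.
by rewrite ltNge; apply/negP => D1; have := ler_wpM2l D0 En; lra.
Qed.
End Diameter.

(** * Lower bound for the resistance of a thread in the branch network *)

(** The energy of a thread of length l between a and b, for the potential that is
    1 at u, 0 at v and c elsewhere, distributed over the ends u and v of the
    thread.  A thread from u to v of length at least two has energy at most
    1/2 <= (1 - c)^2 + c^2; only a single edge u v exceeds that share, by
    2 c (1 - c). *)
Lemma edge_cost_le (R : realFieldType) (T : eqType) (u v a b : T) (c : R) (l : nat) :
  u != v -> a != b -> (0 < l)%N -> (0 <= c <= 1) ->
  let psi z : R := (if z == u then 1 else if z == v then 0 else c) in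
  let au := (a == u) || (b == u) in let av := (a == v) || (b == v) in
  ((psi a - psi b) ^+ 2 / l%:R <= (1 - c) ^+ 2 *+ au + c ^+ 2 *+ av
    + (2 * (c * (1 - c))) *+ [&& au, av & l == 1%N]).
Proof.
move=> uv ab l0 /andP[c0 c1]; rewrite /=.
have k1 : (l%:R^-1 <= 1 :> R) by rewrite invf_le1 ?ler1n ?ltr0n.
have k2 : (l != 1)%N -> (l%:R^-1 <= 1 / 2 :> R).
  by move=> l1; rewrite div1r lef_pV2 ?posrE ?ltr0n // ler_nat; lia.
have c20 : (0 <= c ^+ 2) := sqr_ge0 _.
have d20 : (0 <= (1 - c) ^+ 2) := sqr_ge0 _.
have cd0 : (0 <= c * (1 - c)) by rewrite mulr_ge0 ?subr_ge0.
have cd : (c ^+ 2 + (1 - c) ^+ 2 + 2 * (c * (1 - c)) = 1) by ring.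
(* The bound that makes direct threads of length at least two harmless. *)
have half : (1 / 2 <= c ^+ 2 + (1 - c) ^+ 2) by have := sqr_ge0 (2 * c - 1); lra.
have cs : ((c - 1) ^+ 2 = (1 - c) ^+ 2) by ring.
have ck := ler_piMr c20 k1; have dk := ler_piMr d20 k1.
have [Ea|_] := eqVneq a u; [rewrite Ea in ab *|];
  have [Eb|_] := eqVneq b u; try rewrite Eb in ab *;
  rewrite ?eqxx ?(negPf uv) // ?(eq_sym v) ?(negPf uv) in ab *;
  [have [Ebv|_] := eqVneq b v|have [Eav|_] := eqVneq a v|
   have [Eav|_] := eqVneq a v; [rewrite Eav in ab *|]; have [Ebv|_] := eqVneq b v].
all: rewrite ?orbT ?orbF /= ?mulr1n ?mulr0n ?subr0 ?sub0r ?subrr ?sqrrN ?cs ?expr0n ?mul0r ?expr1n ?mul1r //=.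
all: try lra.
all: have [->|/k2 k2'] := eqVneq l 1%N; rewrite ?invr1 ?mulr1n ?mulr0n; lra.
Qed.

Section BranchNetwork.
Variables (T : finType) (e : rel T).
Hypothesis e_sym : symmetric e.

(** The potential of [edge_cost_le].  The thread h itself has energy 1 / L_h; the
    others are at most deg u - 1 at u and deg v - 1 at v; a second thread that is
    the single edge u v exists only if h is longer. *)
Lemma rho_ge (R : realFieldType) (h : othread e) (c : R) :
  let u := first (val h) in let v := final (val h) in
  0 <= c <= 1 ->
  1 <= rho_ R h * ((olen h)%:R^-1
    + ((deg e u)%:R - 1) * (1 - c) ^+ 2 + ((deg e v)%:R - 1) * c ^+ 2
    + (2 * (c * (1 - c))) *+ ((1 < olen h)%N && e u v)).
Proof.
move=> u v /andP[c0 c1].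
have uv : u != v := ordinary_final_neq h.
have [f0 [of0 L0 fu fv]] := oriented_rep e_sym h.
pose psi (z : T) : R := if z == u then 1 else if z == v then 0 else c.
pose ecost (f : othread e) : R :=
  (psi (first (val f)) - psi (final (val f))) ^+ 2 / (olen f)%:R.
have pu : psi u = 1 by rewrite /psi eqxx.
have pv : psi v = 0 by rewrite /psi eq_sym (negPf uv) eqxx.
have En : energy (branch_network R e) (fun z => psi (val z)) = \sum_(f | oriented f) ecost f.
  by rewrite -sum_sig.
have sub (f : branch e -> R) : (forall k : edge (branch_network R e), f (src k) = f (tgt k)) ->
    f (ofirst h) = f (ofinal h).
  move=> fE; have := fE (exist _ f0 of0) => /= E0.
  have [Eu|nu] := eqVneq (first (val f0)) u.
    have Ev : final (val f0) = v.
      by move: fv; rewrite /endpoint -/v Eu (negPf uv) => /eqP.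
    have -> : ofirst h = ofirst f0 by apply: val_inj.
    by have -> : ofinal h = ofinal f0 by apply: val_inj.
  have Eu : final (val f0) = u by move: fu; rewrite /endpoint -/u (negPf nu) => /eqP.
  have Ev : first (val f0) = v.
    by move: fv; rewrite /endpoint -/v Eu (negPf uv) orbF => /eqP.
  have -> : ofirst h = ofinal f0 by apply: val_inj.
  by have -> : ofinal h = ofirst f0 by apply: val_inj.
have := eff_res_ge (fun z => psi (val z)) sub.
rewrite /= pu pv subr0 expr1n -/(rho_ R h) En => H.
have rho0 : 0 <= rho_ R h.
  have : 0 <= \sum_(f | oriented f) ecost f.
    by apply: sumr_ge0 => f _; rewrite divr_ge0 ?sqr_ge0 ?ler0n.
  move: (\sum_(f | _) _) H => E H E0; rewrite leNgt; apply/negP => r0.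
  by have := mulr_le0_ge0 (ltW r0) E0; lra.
apply: (le_trans H); apply: ler_wpM2l => //.
pose unit_uv (f : othread e) := [&& endpoint f u, endpoint f v & olen f == 1%N].
pose bound (f : othread e) : R := (1 - c) ^+ 2 *+ endpoint f u + c ^+ 2 *+ endpoint f v
   + (2 * (c * (1 - c))) *+ unit_uv f.
have ecost_le (f : othread e) : oriented f -> ecost f <= bound f.
  by move=> _; apply: edge_cost_le; rewrite ?ordinary_final_neq ?c0 //; exact: (arc_gt0 (othread_arc f)).
rewrite (bigD1 f0) //= {1}/ecost.
have f0c : (psi (first (val f0)) - psi (final (val f0))) ^+ 2 / (olen f0)%:R = (olen h)%:R^-1.
  rewrite L0; move: fu fv (ordinary_final_neq f0); rewrite /endpoint -/u -/v /psi.
  have [->|nu] := eqVneq (first (val f0)) u; rewrite /= ?(negPf uv).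
    by move=> _ /eqP-> _; rewrite (eq_sym v) (negPf uv) eqxx subr0 expr1n mul1r.
  move=> /eqP->; rewrite (negPf uv) orbF eqxx => /eqP -> _.
  by rewrite eqxx sub0r sqrrN expr1n mul1r.
rewrite f0c -!addrA lerD2l.
apply: (@le_trans _ _ (\sum_(f | oriented f && (f != f0)) bound f)).
  by apply: ler_sum => f /andP[of1 _]; apply: ecost_le.
have sumn (P : pred (othread e)) (a : R) :
    \sum_(f | oriented f && (f != f0)) a *+ P f
    = a *+ #|[pred f | (oriented f && (f != f0)) && P f]|.
  rewrite -sumr_const [RHS]big_mkcondr /=; apply: eq_bigr => f _; by case: (P f).
have cnt z (a : R) : 0 <= a -> endpoint f0 z ->
    \sum_(f | oriented f && (f != f0)) a *+ endpoint f z <= ((deg e z)%:R - 1) * a.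
  move=> a0 f0z; have := card_endpoint e_sym z; rewrite sumn -[a *+ _]mulr_natl.
  rewrite (cardD1 f0) !inE of0 f0z /= add1n -(ler_nat R) -natr1 => dz.
  apply: ler_wpM2r => //; rewrite lerBrDr; apply: le_trans dz.
  rewrite lerD2r ler_nat; apply: subset_leq_card; apply/subsetP => f.
  by rewrite !inE => /andP[/andP[-> ->] ->].
rewrite /bound !big_split /= [leRHS]addrA; apply: lerD; first by rewrite lerD ?cnt ?sqr_ge0.
rewrite sumn; apply: ler_wpMn2l; first by rewrite !mulr_ge0 ?subr_ge0.
have unit_walk (f : othread e) : unit_uv f -> walk_from f u 1 = v.
  by move=> /and3P[fu' fv' /eqP f1]; apply: walk_from_unit.
have [L1 |L1] := leqP (olen h) 1.
  rewrite leqn0; apply/eqP/eq_card0 => f; rewrite !inE.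
  apply/negP => /andP[/andP[of1 /eqP ff0] uf]; case: ff0.
  have u0 : unit_uv f0.
    by rewrite /unit_uv fu fv L0 eqn_leq L1 (arc_gt0 (othread_arc h)).
  case/and3P: (uf) => fu' _ _.
  by apply: (walk_from_inj e_sym of1 of0 fu' fu); rewrite !unit_walk.
have [uev|nuv] := boolP (e u v); last first.
  rewrite leqn0; apply/eqP/eq_card0 => f; rewrite !inE.
  apply/negP => /andP[_ uf]; case/negP: nuv; case/and3P: (uf) => fu' _ _.
  by rewrite -(unit_walk _ uf); apply: walk_from_nbr.
apply/card_le1_eqP => f f'; rewrite !inE => /andP[/andP[of1 _] uf] /andP[/andP[of2 _] uf'].
case/and3P: (uf) => fu1 _ _; case/and3P: (uf') => fu2 _ _.
by apply: (walk_from_inj e_sym of2 of1 fu2 fu1); rewrite !unit_walk.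
Qed.
End BranchNetwork.

(** * Upper bounds for the cost of a thread *)

Section Bounds.
Variable R : realFieldType.
Implicit Types s l d a b m rho kap p q n : R.

(** C_h as a function of the length, delta_h, a_h, the index of the selected edge
    and rho_h. *)
Definition cost s l d a m rho : R :=
  let t := (m + a) / (l - d) in
  (s * l - d) * t * (1 - t) + (1 - s) * (l - rho) * ((t - m / l) * ((m + 1) / l - t)).

(** The bound F(n) for the cost of an edge between branch vertices with degree
    sum n. *)
Definition unit_bound n s : R := 2 / (n * (n + 2)) + 9 / 8 * s * ((n - 2) / n ^+ 2).

(** For an edge the cost is 1/n - (1 - s) rho p q / n^2 with n = p + q.  After the
    substitution of the bound for rho, the part without s is largest for p = q,
    and p q / (p q - 1) <= 9/8. *)
Lemma cost_unit p q s rho : 3 <= p -> 3 <= q -> 0 <= s <= 1 ->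
  p + q - 2 <= rho * (p * q - 1) ->
  cost s 1 (1 - p^-1 - q^-1) p^-1 0 rho <= unit_bound (p + q) s.
Proof.
move=> p3 q3 /andP[s0 s1] Hr.
have P9 : 9 <= p * q by nra.
have n0 : p + q != 0 by rewrite gt_eqF //; lra.
have -> : cost s 1 (1 - p^-1 - q^-1) p^-1 0 rho
    = (p + q)^-1 - (1 - s) * rho * (p * q) / (p + q) ^+ 2.
  rewrite /cost; field; rewrite n0 !gt_eqF //=; lra.
have N4 : 4 * (p * q) <= (p + q) ^+ 2 by have := sqr_ge0 (p - q); nra.
move: Hr P9 N4 n0; set n := p + q; set P := p * q => Hr P9 N4 n0.
have n6 : 6 <= n by rewrite /n; lra.
have P1 : 0 < P - 1 by lra.
have rE : (n - 2) * (P / (P - 1)) <= rho * P.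
  rewrite mulrA ler_pdivrMr //.
  have -> : rho * P * (P - 1) = rho * (P - 1) * P by ring.
  by apply: ler_wpM2r => //; lra.
have k1 : 4 / (n + 2) <= (n - 2) / (P - 1).
  rewrite ler_pdivrMr; last by lra.
  rewrite mulrAC ler_pdivlMr //.
  have -> : (n - 2) * (n + 2) = n ^+ 2 - 4 by ring.
  by lra.
have k2 : P / (P - 1) <= 9 / 8 by rewrite ler_pdivrMr //; lra.
have k3 : P / (P - 1) = 1 + 1 / (P - 1) by field; rewrite gt_eqF.
rewrite -subr_ge0.
have -> : unit_bound n s - (n^-1 - (1 - s) * rho * P / n ^+ 2)
   = (n ^+ 2)^-1 * ((1 - s) * (rho * P - (n - 2) * (P / (P - 1)))
       + ((n - 2) / (P - 1) - 4 / (n + 2)) + s * ((n - 2) * (9 / 8 - P / (P - 1)))).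
  rewrite /unit_bound; field; rewrite n0 gt_eqF //= gt_eqF //; lra.
have t1 : 0 <= (1 - s) * (rho * P - (n - 2) * (P / (P - 1))).
  by rewrite mulr_ge0 ?subr_ge0.
have t2 : 0 <= s * ((n - 2) * (9 / 8 - P / (P - 1))).
  by rewrite !mulr_ge0 ?subr_ge0 //; lra.
rewrite mulr_ge0 ?invr_ge0 ?sqr_ge0 //.
by apply: addr_ge0 t2; apply: (addr_ge0 t1); rewrite subr_ge0.
Qed.

Lemma unit_bound_le n n' s : 6 <= n -> n <= n' -> 0 <= s -> unit_bound n' s <= unit_bound n s.
Proof.
move=> n6 nn' s0; rewrite /unit_bound; apply: lerD.
  rewrite ler_pM2l // lef_pV2 ?posrE ?mulr_gt0 //; try lra.
  by apply: ler_pM; lra.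
apply: ler_wpM2l; first by lra.
have h1 : 0 <= n' - n by lra.
have h2 : 0 <= (n - 2) * (n' - 2) - 4.
  have -> : (n - 2) * (n' - 2) - 4 = (n - 4) * (n' - 4) + 2 * (n + n' - 8) by ring.
  by rewrite addr_ge0 ?mulr_ge0 //; lra.
rewrite -subr_ge0.
have -> : (n - 2) / n ^+ 2 - (n' - 2) / n' ^+ 2
   = (n' - n) * ((n - 2) * (n' - 2) - 4) / (n * n') ^+ 2.
  by field; rewrite !gt_eqF //; lra.
by rewrite divr_ge0 ?sqr_ge0 // mulr_ge0.
Qed.

(** For a given sum, 1/p + 1/q is largest when p and q are furthest apart. *)
Lemma inv_sum_le k p q : 0 < k -> k <= p -> k <= q ->
  p^-1 + q^-1 <= k^-1 + (p + q - k)^-1.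
Proof.
move=> k0 kp kq; rewrite -subr_ge0.
have -> : k^-1 + (p + q - k)^-1 - (p^-1 + q^-1)
   = (p + q) * ((p - k) * (q - k)) / (k * (p + q - k) * (p * q)).
  by field; rewrite !gt_eqF //; lra.
by rewrite divr_ge0 ?mulr_ge0 ?subr_ge0 //; lra.
Qed.

Section Long.
Variables (s l a b i j rho kap : R).
Hypotheses (a0 : 0 < a) (b0 : 0 < b) (i0 : 0 <= i) (j0 : 0 <= j).
Hypotheses (lE : l = i + j + 1) (d0 : 0 < 1 - a - b).
Hypothesis (kap0 : 0 < kap).
Hypothesis (rho_kap : 1 <= rho * (l^-1 + kap)).
Local Notation d := (1 - a - b).
Local Notation tau := (i + j + a + b).
Local Notation T := ((i + a) * (j + b) / tau ^+ 2).
Local Notation E := ((a * l + i * d) * (b * l + j * d) / (l * tau) ^+ 2).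
Local Notation W := (l ^+ 2 * kap / (1 + l * kap)).
Let l0 : 0 < l. Proof. by rewrite lE ltr_wpDl ?addr_ge0. Qed.
Let tau0 : 0 < tau. Proof. by rewrite -addrA ltr_wpDl ?addr_gt0 ?addr_ge0. Qed.

Lemma cost_expand : cost s l d a i rho = (s * l - d) * T + (1 - s) * (l - rho) * E.
Proof.
have := l0; rewrite /cost lE => l0'.
field; rewrite !gt_eqF //; lra.
Qed.

Lemma eps_ge0 : 0 <= E.
Proof. by rewrite divr_ge0 ?sqr_ge0 // mulr_ge0 // addr_ge0 // mulr_ge0 // ltW. Qed.

(** The two factors of l^2 eps add up to 1. *)
Lemma eps_le : l ^+ 2 * E <= 1 / 4.
Proof.
have -> : E = (a * l + i * d) * (b * l + j * d) / tau ^+ 2 / l ^+ 2.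
  by field; rewrite !gt_eqF.
rewrite mulrCA mulfV ?mulr1; last by rewrite gt_eqF // exprn_gt0.
rewrite ler_pdivrMr ?exprn_gt0 //.
have -> : tau = (a * l + i * d) + (b * l + j * d) by rewrite lE; ring.
move: (a * l + i * d) (b * l + j * d) => A B.
by have := sqr_ge0 (A - B); nra.
Qed.

(** With kap the conductance between the ends outside h, the bound is the value of
    l - rho for the parallel connection of h and that conductance. *)
Lemma len_sub_rho_le : l - rho <= W.
Proof.
have lk : 0 < 1 + l * kap by rewrite addr_gt0 // mulr_gt0.
have : l <= rho * (1 + l * kap).
  have -> : rho * (1 + l * kap) = l * (rho * (l^-1 + kap)) by field; rewrite gt_eqF.
  by rewrite ler_peMr // ltW.
move=> H; rewrite ler_pdivlMr // mulrBl.
have -> : l * (1 + l * kap) = l ^+ 2 * kap + l by ring.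
by lra.
Qed.

Lemma gap_le : W <= l.
Proof.
rewrite ler_pdivrMr; last by rewrite addr_gt0 // mulr_gt0.
have := l0; have := kap0; nra.
Qed.

Lemma cost_le_gap : s <= 1 -> cost s l d a i rho <= (s * l - d) * T + (1 - s) * (W * E).
Proof.
move=> s1; rewrite cost_expand lerD2l -mulrA ler_wpM2l ?subr_ge0 //.
by rewrite ler_wpM2r ?eps_ge0 ?len_sub_rho_le.
Qed.

Lemma gap_eps_le : W * E <= kap / (4 * (1 + l * kap)).
Proof.
have lk : 0 < 1 + l * kap by rewrite addr_gt0 // mulr_gt0.
have := eps_le; move: E => X EX.
have -> : W * X = kap / (1 + l * kap) * (l ^+ 2 * X) by field; rewrite gt_eqF.
have -> : kap / (4 * (1 + l * kap)) = kap / (1 + l * kap) * (1 / 4).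
  by field; rewrite gt_eqF.
by rewrite ler_wpM2l // divr_ge0 // ltW.
Qed.

(** The main terms of l eps and d t (1 - t) cancel; what remains is at most a b / tau,
    which is attained at the first and at the last edge. *)
Lemma len_eps_sub : l * E - d * T = (a * b - i * j * d / l) / tau.
Proof.
have := l0; rewrite lE => l0'.
by field; rewrite !gt_eqF //; lra.
Qed.

(** The bound for the cost and the claim are both affine in s, so it suffices to
    compare them at s = 0 and at s = d / l. *)
Lemma cost_interp : 0 <= s -> s * l <= d -> s <= 1 ->
  W * E - d * T <= 1 / 24 -> (1 - d / l) * (W * E) <= 1 / 24 + d / (5 * l) ->
  cost s l d a i rho <= 1 / 24 + s / 5.
Proof.
move=> s0 sl s1 HA HB; apply: (le_trans (cost_le_gap s1)).
(* The position of s between 0 and d / l. *)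
pose th := s * l / d.
have th0 : 0 <= th by rewrite /th divr_ge0 ?mulr_ge0 // ltW.
have th1 : th <= 1 by rewrite /th ler_pdivrMr // mul1r.
have sE : s = th * (d / l) by rewrite /th; field; rewrite !gt_eqF.
have -> : (s * l - d) * T + (1 - s) * (W * E)
  = (1 - th) * (W * E - d * T) + th * ((1 - d / l) * (W * E)).
  by move: (W * E) T => X Y; rewrite {1 2}sE; field; rewrite gt_eqF.
have -> : 1 / 24 + s / 5 = (1 - th) * (1 / 24) + th * (1 / 24 + d / (5 * l)).
  by rewrite {1}sE; field; rewrite gt_eqF.
by rewrite lerD // ler_wpM2l // subr_ge0.
Qed.

(** When s l = d the first term of the cost vanishes. *)
Lemma cost_extremal : s * l = d -> s <= 1 ->
  cost s l d a i rho <= (1 - s) * (kap / (4 * (1 + l * kap))).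
Proof.
move=> sl s1; apply: (le_trans (cost_le_gap s1)).
by rewrite sl subrr mul0r add0r ler_wpM2l ?gap_eps_le // subr_ge0.
Qed.
End Long.
End Bounds.

(** The degrees of the ends of a thread of length two for which rho >= 0 alone is
    too weak in [cost_long]. *)
Lemma small_degrees p q : (2 < p)%N -> (2 < q)%N -> (p * q + (p + q) < 24)%N ->
  [\/ p = 3 /\ q = 3, p = 3 /\ q = 4, p = 4 /\ q = 3 | (p = 3 /\ q = 5) \/ (p = 5 /\ q = 3)]%N.
Proof.
move=> p3 q3 pq; have p5 : (p <= 5)%N by nia.
have q5 : (q <= 5)%N by nia.
case: p p3 p5 pq => [|[|[|[|[|[|p]]]]]] // _ _; case: q q3 q5 => [|[|[|[|[|[|q]]]]]] // _ _ _;
  by [constructor 1|constructor 2|constructor 3|constructor 4; left|constructor 4; right].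
Qed.

Section LongBound.
Variable R : realFieldType.

Lemma inv_nat_bounds (p : nat) : (3 <= p)%N -> 0 < (p%:R^-1 : R) <= 1 / 3.
Proof.
move=> p3; rewrite invr_gt0 ltr0n (leq_trans _ p3) //= div1r lef_pV2 ?posrE ?ltr0n ?ler_nat //.
by rewrite (leq_trans _ p3).
Qed.

Lemma delta_ge (k p q : nat) : (0 < k)%N -> (k <= p)%N -> (k <= q)%N ->
  1 - k%:R^-1 - ((p + q)%:R - k%:R)^-1 <= 1 - p%:R^-1 - q%:R^-1 :> R.
Proof.
move=> k0 kp kq; rewrite natrD.
have := @inv_sum_le R k%:R p%:R q%:R; rewrite ltr0n !ler_nat => /(_ k0 kp kq).
by lra.
Qed.

Lemma delta_ge_num (k r p q : nat) : (0 < k)%N -> (k <= p)%N -> (k <= q)%N ->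
  (0 < r)%N -> (k + r <= p + q)%N ->
  1 - k%:R^-1 - r%:R^-1 <= 1 - p%:R^-1 - q%:R^-1 :> R.
Proof.
move=> k0 kp kq r0 kr; apply: le_trans (delta_ge k0 kp kq).
rewrite lerD2l lerN2 lef_pV2 ?posrE ?subr_gt0 ?ltr0n ?ltr_nat //; last by lia.
by rewrite lerBrDl -natrD ler_nat.
Qed.

Lemma kappa_le (k l : R) : 0 < k -> 0 < l -> k / (4 * (1 + l * k)) <= 1 / (4 * l).
Proof.
move=> k0 l0; rewrite -subr_ge0.
have lk : 0 < l * k by rewrite mulr_gt0.
have -> : 1 / (4 * l) - k / (4 * (1 + l * k)) = 1 / (4 * l * (1 + l * k)).
  by field; rewrite !gt_eqF //; lra.
by rewrite divr_ge0 // !mulr_ge0 //; lra.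
Qed.

Lemma kappa_mono (k k' l : R) : 0 < k -> k <= k' -> 0 < l ->
  k / (4 * (1 + l * k)) <= k' / (4 * (1 + l * k')).
Proof.
move=> k0 kk l0; rewrite -subr_ge0.
have lk : 0 < l * k by rewrite mulr_gt0.
have lk' : 0 < l * k' by rewrite mulr_gt0 //; lra.
have -> : k' / (4 * (1 + l * k')) - k / (4 * (1 + l * k))
  = (k' - k) / (4 * (1 + l * k) * (1 + l * k')).
  by field; rewrite !gt_eqF //; lra.
by rewrite divr_ge0 // ?mulr_ge0 //; lra.
Qed.

Lemma inv_prod_le (a b : R) : 0 <= a -> a <= 1 / 3 -> 0 <= b -> b <= 1 / 3 ->
  24 * (a * b) <= 2 + a + b.
Proof.
move=> a0 a1 b0 b1; have := ler_wpM2r a0 b1; have := ler_wpM2l b0 a1.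
by rewrite (mulrC b a); lra.
Qed.

(** At s = 0 the identity [len_eps_sub] suffices, except for length two and small
    degrees.  At s = d / l the crude bound 1 / (4 l) suffices for l >= 4;
    for shorter threads a small degree sum n makes kap = n / 4 small while a large
    one makes d large.  For l = 2, p = q = 3, s = 1/6 and the least rho, equality holds. *)
Lemma cost_long (p q m l : nat) (s rho : R) :
  (3 <= p)%N -> (3 <= q)%N -> (m < l)%N -> (1 < l)%N ->
  let d : R := 1 - p%:R^-1 - q%:R^-1 in
  0 <= s -> s <= 1 -> s * l%:R <= d -> 1 <= rho * (l%:R^-1 + (p + q)%:R / 4) ->
  cost s l%:R d p%:R^-1 m%:R rho <= 1 / 24 + s / 5.
Proof.
move=> p3 q3 ml l1.
have pq0 : (0 < p + q)%N by lia.
have p0 : (0 < p)%N by lia.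
have q0 : (0 < q)%N by lia.
have l0N : (0 < l)%N by lia.
have P0N : (0 < p * q)%N by rewrite muln_gt0; lia.
have [j jE] : exists j : nat, (l = m + j + 1)%N by exists (l - 1 - m)%N; lia.
have mj1 : (l < 3)%N -> (m + j = 1)%N by lia.
have mj2 : (l < 3)%N -> ((m = 0 /\ j = 1) \/ (m = 1 /\ j = 0))%N by lia.
have l2E : (l < 3)%N -> l = 2%N by lia.
have small := small_degrees p3 q3.
move=> d s0 s1 sd Hr.
have /andP[a0 a1] := inv_nat_bounds p3; have /andP[b0 b1] := inv_nat_bounds q3.
have lE : l%:R = m%:R + j%:R + 1 :> R by rewrite jE !natrD.
have i0 : 0 <= m%:R :> R by rewrite ler0n.
have j0 : 0 <= j%:R :> R by rewrite ler0n.
have d0 : 0 < d by rewrite /d; lra.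
have d13 : 1 / 3 <= d by rewrite /d; lra.
have k0 : 0 < (p + q)%:R / 4 :> R by rewrite divr_gt0 // ltr0n.
have l0 : 0 < l%:R :> R by rewrite ltr0n.
apply: (cost_interp a0 b0 i0 j0 lE d0 k0 Hr) => //; rewrite -/d.
- set E := _ / (l%:R * _) ^+ 2; set T := _ / _ ^+ 2.
  have EE : l%:R * E - d * T
     = (p%:R^-1 * q%:R^-1 - m%:R * j%:R * d / l%:R) / (m%:R + j%:R + p%:R^-1 + q%:R^-1).
    exact: (len_eps_sub a0 b0 i0 j0 lE).
  have E0 : 0 <= E by exact: eps_ge0.
  have crude : 24 * (p%:R^-1 * q%:R^-1) <= m%:R + j%:R + p%:R^-1 + q%:R^-1 :> R ->
      l%:R ^+ 2 * ((p + q)%:R / 4) / (1 + l%:R * ((p + q)%:R / 4)) * E - d * T <= 1 / 24.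
    move=> H; apply: (@le_trans _ _ (l%:R * E - d * T)).
      rewrite lerD2r ler_wpM2r //; exact: gap_le i0 j0 lE k0.
    have tau0 : 0 < m%:R + j%:R + p%:R^-1 + q%:R^-1 :> R.
      by rewrite -addrA ltr_wpDl ?addr_gt0 ?addr_ge0.
    have mjd : 0 <= m%:R * j%:R * d / l%:R by rewrite divr_ge0 ?mulr_ge0 // ltW.
    rewrite EE ler_pdivrMr //; move: H mjd; clear; lra.
  have [l3|l2] := leqP 3 l.
    apply: crude; have l3' : 3 <= l%:R :> R by rewrite ler_nat.
    apply: le_trans (inv_prod_le (ltW a0) a1 (ltW b0) b1) _.
    by rewrite !lerD2r; move: l3' lE; clear; lra.
  have [pq|pq] := leqP 24 (p * q + (p + q)).
    apply: crude; have -> : m%:R + j%:R = 1 :> R by rewrite -natrD mj1.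
    have P0 : 0 < (p * q)%:R :> R by rewrite ltr0n.
    have : 24 <= (p * q + (p + q))%:R :> R by rewrite ler_nat.
    rewrite -(ler_pM2r (x := (p * q)%:R^-1)) ?invr_gt0 //.
    rewrite natrM natrD natrM natrD invfM.
    have -> : (p%:R * q%:R + (p%:R + q%:R)) * (p%:R^-1 * q%:R^-1) = 1 + p%:R^-1 + q%:R^-1 :> R.
      by field; rewrite !pnatr_eq0 -!lt0n p0 q0.
    by [].
  rewrite /E /T /d (l2E l2).
  (* The ten remaining cases, each with the exact slack. *)
  have gap (x y c : R) : 0 <= c -> y - x = c -> x <= y by move=> c0 yx; rewrite -subr_ge0 yx.
  clear -gap l2 mj2 small pq.
  case: (mj2 l2) => -[-> ->]; case: (small pq) => [[-> ->]|[-> ->]|[-> ->]|[[-> ->]|[-> ->]]].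
  + by apply: (gap _ _ (1 / 200)); [lra|field].
  + by apply: (gap _ _ (419 / (72 * 361))); [lra|field].
  + by apply: (gap _ _ (113 / (24 * 361))); [lra|field].
  + by apply: (gap _ _ (289 / (24 * 529))); [lra|field].
  + by apply: (gap _ _ (1109 / (120 * 529))); [lra|field].
  + by apply: (gap _ _ (1 / 200)); [lra|field].
  + by apply: (gap _ _ (113 / (24 * 361))); [lra|field].
  + by apply: (gap _ _ (419 / (72 * 361))); [lra|field].
  + by apply: (gap _ _ (1109 / (120 * 529))); [lra|field].
  + by apply: (gap _ _ (289 / (24 * 529))); [lra|field].
- set WE := (X in _ * X <= _).
  have WE_b : WE <= (p + q)%:R / 4 / (4 * (1 + l%:R * ((p + q)%:R / 4))).
    by rewrite /WE; apply: gap_eps_le.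
  have dl1 : d / l%:R <= 1.
    by rewrite ler_pdivrMr // mul1r (le_trans (y := 1)) ?ler1n // /d; move: a0 b0; clear; lra.
  have by_bound c : WE <= c -> (1 - d / l%:R) * c <= 1 / 24 + d / (5 * l%:R) ->
      (1 - d / l%:R) * WE <= 1 / 24 + d / (5 * l%:R).
    by move=> Wc; apply: le_trans; rewrite ler_wpM2l ?subr_ge0.
  have n_ge k : (k <= p + q)%N -> k%:R <= (p + q)%:R :> R by rewrite ler_nat.
  have k_le (k : nat) : (p + q <= k)%N ->
      WE <= k%:R / 4 / (4 * (1 + l%:R * (k%:R / 4))).
    move=> nk; apply: le_trans WE_b _; apply: kappa_mono => //.
    have : (p + q)%:R <= k%:R :> R by rewrite ler_nat.
    by clear; lra.
  have crude : WE <= 1 / (4 * l%:R) by apply: le_trans WE_b _; apply: kappa_le.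
  have dn r : (3 + r.+1 <= p + q)%N -> 1 - 3^-1 - r.+1%:R^-1 <= d.
    exact: delta_ge_num.
  have [l4|l3] := leqP 4 l.
    apply: (by_bound _ crude).
    have y0 : 0 < l%:R^-1 :> R by rewrite invr_gt0.
    have y4 : l%:R^-1 <= 1 / 4 :> R by rewrite div1r lef_pV2 ?posrE // ler_nat.
    have -> : 1 / (4 * l%:R) = l%:R^-1 / 4 :> R by rewrite invfM mul1r mulrC.
    have -> : d / (5 * l%:R) = d * l%:R^-1 / 5 by rewrite invfM mulrA mulrAC.
    move: y0 y4 d13; clear; move: (l%:R^-1) => y y0 y4 d13.
    have := ler_wpM2r (ltW y0) d13; have := sqr_ge0 (y - 1 / 4).
    have := ler_wpM2r (mulr_ge0 (ltW y0) (ltW y0)) d13.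
    by lra.
  have [l3E|l2] := eqVneq l 3%N.
    have [n8|n7] := leqP 8 (p + q).
      apply: (by_bound _ crude); have := dn 4%N n8; rewrite l3E.
      by clearbody d; clear; lra.
    apply: (by_bound (7 / 100)); last by move: d13; rewrite l3E; clearbody d; clear; lra.
    have := k_le 7%N n7; rewrite l3E.
    by have -> : 7 / 4 / (4 * (1 + 3 * (7 / 4))) = 7 / 100 :> R by field.
  have {}l2E : l = 2%N by move: l3 l2 l1; clear; lia.
  have [n10|n9] := leqP 10 (p + q).
    apply: (by_bound _ crude); have := dn 6%N n10; rewrite l2E.
    by clearbody d; clear; lra.
  have [n7|n6] := leqP 7 (p + q).
    apply: (by_bound (9 / 88)); last by move: (dn 3%N n7); rewrite l2E; clearbody d; clear; lra.
    have := k_le 9%N n9; rewrite l2E.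
    by have -> : 9 / 4 / (4 * (1 + 2 * (9 / 4))) = 9 / 88 :> R by field.
  have [pE qE] : p = 3%N /\ q = 3%N by move: p3 q3 n6; clear; lia.
  have l2' : (l < 3)%N by rewrite l2E.
  have WEe : WE = 9 / 100.
    by rewrite /WE /d l2E pE qE; case: (mj2 l2') => -[-> ->]; field.
  rewrite WEe /d l2E pE qE; clear; lra.
Qed.
End LongBound.

(** * Numerical comparison of costs with the diameter *)

Section Cases.
Variable R : realFieldType.

(** The peak of [hat] at position floor(L/2). *)
Definition half_res (L : nat) : R := (L./2)%:R * (L%:R - (L./2)%:R) / L%:R.

(** For even L the product s lam is d / 4, for odd L it is d / 4 - s / (4 L). *)
Lemma half_res_cases (L : nat) (s d : R) : (1 < L)%N -> 0 < s -> s * L%:R = d ->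
  [\/ [/\ L = 2%N, s * half_res L = s / 2 & d = 2 * s],
      [/\ L = 3%N, s * half_res L = 2 * s / 3 & d = 3 * s] |
      [/\ (4 <= L)%N, d / 4 - s / 20 <= s * half_res L & 4 * s <= d]].
Proof.
move=> L1 s0 sd; have [L2|L2] := eqVneq L 2%N.
  by constructor 1; split; rewrite // -?sd L2 /half_res /=; field.
have [L3|L3] := eqVneq L 3%N.
  by constructor 2; split; rewrite // -?sd L3 /half_res /=; field.
have L4 : (4 <= L)%N by lia.
have L4' : 4 <= L%:R :> R by rewrite ler_nat.
constructor 3; split=> //; last by rewrite -sd mulrC ler_wpM2l // ltW.
have ho := odd_double_half L.
rewrite /half_res -sd; set k := L./2 in ho *.
have LE : L%:R = (odd L)%:R + 2 * k%:R :> R by rewrite -[in LHS]ho natrD -mul2n natrM.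
have -> : s * L%:R / 4 - s / 20 = s * (L%:R / 4 - 1 / 20) by ring.
apply: ler_wpM2l; first exact: ltW.
rewrite ler_pdivlMr; last by lra.
case oL: (odd L) LE => /= LE.
  have : 5 <= L%:R :> R by rewrite ler_nat; lia.
  by rewrite LE => L5; nra.
by rewrite LE; nra.
Qed.

(** A thread of length one that ends at a vertex of degree d off g: the bound for
    its cost minus the contribution of that vertex to s D, linearized in s. *)
Lemma unit_off_cases (d : nat) (s : R) : (3 <= d)%N -> 0 <= s ->
  let X := unit_bound (d%:R + 3) s - s / d%:R in
  (d = 3%N /\ X <= 1 / 24 - 5 / 24 * s) \/
  ((4 <= d)%N /\ (X <= 2 / 63 - 53 / 392 * s \/ X <= 1 / 40 - 121 / 1280 * s \/
   X <= 2 / 99 - 5 / 72 * s \/ X <= 1 / 60 - 37 / 700 * s \/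
   X <= 2 / 143 - 5 / 121 * s \/ X <= 1 / 84 + 1 / 1000 * s)).
Proof.
move=> d3 s0 X.
have eqW (x y : R) : x = y -> x <= y by move=> ->.
have [d9|d8] := leqP 9 d; last first.
  have : [\/ d = 3%N, d = 4%N, d = 5%N | d = 6%N \/ d = 7%N \/ d = 8%N].
    by move: d3 d8; clear; case: d => [|[|[|[|[|[|[|[|[|d]]]]]]]]] // _ _;
      [constructor 1|constructor 2|constructor 3|constructor 4; left|
       constructor 4; right; left|constructor 4; right; right].
  rewrite /X /unit_bound; case=> [dE|dE|dE|[dE|[dE|dE]]]; rewrite dE.
  - left; split=> //; by apply: eqW; field.
  - right; split=> //; left; by apply: eqW; field.
  - right; split=> //; right; left; by apply: eqW; field.
  - right; split=> //; do 2 right; left; by apply: eqW; field.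
  - right; split=> //; do 3 right; left; by apply: eqW; field.
  - right; split=> //; do 4 right; left.
    by apply: eqW; field.
right; split; [lia|do 5 right].
have d9' : 9 <= d%:R :> R by rewrite ler_nat.
rewrite /X /unit_bound; move: d9'; clear -s0; move: (d%:R) => x x9.
have k1 : 2 / ((x + 3) * (x + 3 + 2)) <= 1 / 84.
  rewrite ler_pdivrMr ?mulr_gt0 //; try lra.
  have : 12 * 14 <= (x + 3) * (x + 3 + 2) by apply: ler_pM; lra.
  by lra.
(* The left-hand side becomes positive near x = 41 and stays below 1/1000. *)
have k2 : 9 / 8 * ((x + 3 - 2) / (x + 3) ^+ 2) - x^-1 <= 1 / 1000.
  rewrite -subr_ge0.
  have -> : 1 / 1000 - (9 / 8 * ((x + 3 - 2) / (x + 3) ^+ 2) - x^-1)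
    = (x * ((x - 119 / 2) ^+ 2 + 5375 / 4) + 9000) / (1000 * x * (x + 3) ^+ 2).
    by field; rewrite !gt_eqF //; lra.
  have x0 : 0 <= x by lra.
  apply: divr_ge0; last by apply: mulr_ge0 (sqr_ge0 _); apply: mulr_ge0.
  apply: addr_ge0 => //; apply: (mulr_ge0 x0); apply: (addr_ge0 (sqr_ge0 _)).
  by rewrite divr_ge0.
have := ler_wpM2l s0 k2; move: k1; move: (2 / _) (_ / _ ^+ 2) (x^-1) => A B C; lra.
Qed.

End Cases.

(** The bound of [cost_extremal], for the thread g. *)
Definition extremal_bound (R : realFieldType) (L : nat) (s kap : R) : R :=
  (1 - s) * (kap / (4 * (1 + L%:R * kap))).

Lemma two_long_lt (R : realFieldType) (L : nat) (s d : R) :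
  (1 < L)%N -> 0 < s -> s * L%:R = d ->
  1 / 3 <= d ->
  (1 / 24 + s / 5) + (1 / 24 + s / 5) < s * (half_res R L + 1 / 2).
Proof.
move=> L1 s0 sL d13; rewrite mulrDr.
by case: (half_res_cases L1 s0 sL) => -[_ H1 H2]; move: s0 d13 H1 H2; clear;
  move: (s * half_res _ _) => K; lra.
Qed.

(** Both sides agree for L = 3, dw = 3 and d = 1/3. *)
Lemma two_unit_lt (R : realFieldType) (L dw : nat) (s d : R) :
  (1 < L)%N -> 0 < s -> s * L%:R = d ->
  1 / 3 <= d -> (3 <= dw)%N ->
  (L = 3%N -> dw = 3%N -> 1 / 3 < d) ->
  unit_bound (dw%:R + 3) s + (1 / 24 + s / 8) < s * (half_res R L + dw%:R^-1).
Proof.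
move=> L1 s0 sL d13 dw3 tie; rewrite mulrDr.
have [] := unit_off_cases dw3 (ltW s0); set X := unit_bound _ _ - _.
  move=> [dwE HX]; suff : X + (1 / 24 + s / 8) < s * half_res R L.
    by rewrite /X; move: (s / _) => Y; lra.
  case: (half_res_cases L1 s0 sL) => -[LE H1 H2].
  - by move: s0 d13 HX H1 H2; clear; move: (s * half_res _ _) X => K X; lra.
  - by move: (tie LE dwE) s0 d13 HX H1 H2; clear; move: (s * half_res _ _) X => K X; lra.
  - by move: s0 d13 HX H1 H2; clear; move: (s * half_res _ _) X => K X; lra.
move=> [dw4 HX]; suff : X + (1 / 24 + s / 8) < s * half_res R L.
  by rewrite /X; move: (s / _) => Y; lra.
case: (half_res_cases L1 s0 sL) => -[_ H1 H2]; move: s0 d13 HX H1 H2; clear;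
  move: (s * half_res _ _) X => K X s0 d13 HX H1 H2;
  by case: HX => [|[|[|[|[|]]]]]; lra.
Qed.

Lemma extremal_bound_crude (R : realFieldType) (L : nat) (s kap : R) :
  (0 < L)%N -> 0 < kap -> s <= 1 ->
  extremal_bound L s kap <= (1 - s) * (1 / (4 * L%:R)).
Proof.
move=> L0 k0 s1; rewrite /extremal_bound ler_wpM2l ?subr_ge0 //.
by apply: kappa_le; rewrite // ltr0n.
Qed.

Lemma extremal_bound_le3 (R : realFieldType) (L : nat) (s G : R) :
  G <= (1 - s) * (1 / (4 * L%:R)) -> L = 3%N -> G <= (1 - s) / 12.
Proof. by move=> GE LE; move: GE; rewrite LE; lra. Qed.

Lemma extremal_bound_le4 (R : realFieldType) (L : nat) (s G : R) : s <= 1 ->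
  G <= (1 - s) * (1 / (4 * L%:R)) -> (4 <= L)%N -> G <= (1 - s) / 16.
Proof.
move=> s1 GE LE; apply: le_trans GE _; have : 4 <= L%:R :> R by rewrite ler_nat.
by move=> L4; rewrite ler_wpM2l ?subr_ge0 // div1r lef_pV2 ?posrE; lra.
Qed.

(** The three alternatives for d and kap correspond to the degree sums 6, 7 and at
    least 8 of the ends of g; for degree sum 6 the ends are not adjacent, which
    allows kap = 1 in place of 3/2.  Both sides agree for L = 3, dw = 3, d = 1/3. *)
Lemma extremal_unit_lt (R : realFieldType) (L dw : nat) (s d kap : R) :
  (1 < L)%N -> 0 < s -> s * L%:R = d -> 3 * s <= 1 -> (3 <= dw)%N ->
  (d = 1 / 3 /\ kap = 1) \/ (5 / 12 <= d /\ kap = 7 / 4) \/ (7 / 15 <= d /\ 0 < kap) ->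
  (L = 3%N -> dw = 3%N -> 1 / 3 < d) ->
  extremal_bound L s kap + unit_bound (dw%:R + 3) s < s * (half_res R L + dw%:R^-1).
Proof.
move=> L1 s0 sL s3 dw3 dk tie; rewrite mulrDr.
have s1 : s <= 1 by lra.
have k0 : 0 < kap by case: dk => [[_ ->]|[[_ ->]|[]]]; lra.
have crude := extremal_bound_crude (ltnW L1) k0 s1.
set X := unit_bound (dw%:R + 3) s - s / dw%:R.
suff : extremal_bound L s kap + X < s * half_res R L.
  by rewrite /X; move: (s / _) => Y; lra.
have HX := unit_off_cases dw3 (ltW s0); rewrite -/X in HX.
case: (half_res_cases L1 s0 sL) => -[LE H1 H2].
- have G : (d = 1 / 3 /\ extremal_bound L s kap = (1 - s) / 12) \/
    (5 / 12 <= d /\ extremal_bound L s kap <= (1 - s) * (7 / 72)) \/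
    (7 / 15 <= d /\ extremal_bound L s kap <= (1 - s) / 8).
    case: dk => [[dE kE]|[[dE kE]|[dE _]]]; [left|right;left|right;right]; split=> //.
    + by rewrite /extremal_bound LE kE; field.
    + by rewrite le_eqVlt; apply/orP; left; apply/eqP; rewrite /extremal_bound LE kE; field.
    + by move: crude; rewrite LE; lra.
  move: s0 s3 HX H1 H2 G; clear; move: (extremal_bound L s kap) (s * half_res _ _) X.
  move=> G K X s0 s3 HX H1 H2 HG.
  case: HG => [[dE GE]|[[dE GE]|[dE GE]]];
  case: HX => [[_ HX]|[_ [HX|[HX|[HX|[HX|[HX|HX]]]]]]]; lra.
- have G : (d = 1 / 3 /\ extremal_bound L s kap = (1 - s) / 16) \/
    (5 / 12 <= d /\ extremal_bound L s kap <= (1 - s) / 12).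
    case: dk => [[dE kE]|dk]; [left|right]; split=> //.
    + by rewrite /extremal_bound LE kE; field.
    + by case: dk => -[H _]; move: H; clear; lra.
    + by move: crude; rewrite LE; lra.
  have tie' : dw = 3%N -> 1 / 3 < d by exact: tie.
  move: s0 s3 HX H1 H2 tie' G; clear; move: (extremal_bound L s kap) (s * half_res _ _) X.
  move=> G K X s0 s3 HX H1 H2 tie HG.
  case: HG => [[dE GE]|[dE GE]];
  case: HX => [[/tie dl HX]|[_ [HX|[HX|[HX|[HX|[HX|HX]]]]]]]; lra.
- have G : (d = 1 / 3 /\ ((12 * s = 1 /\ extremal_bound L s kap = (1 - s) / 20) \/
      extremal_bound L s kap <= (1 - s) / 24)) \/
    (5 / 12 <= d /\ extremal_bound L s kap <= (1 - s) / 16).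
    case: dk => [[dE kE]|dk]; [left|right]; split=> //.
    + have [L4|L4] := eqVneq L 4%N; [left|right].
        split; first by move: sL; rewrite L4 dE; clear; lra.
        by rewrite /extremal_bound L4 kE; field.
      have L5 : 5 <= L%:R :> R by rewrite ler_nat ltn_neqAle eq_sym L4.
      rewrite /extremal_bound kE ler_wpM2l ?subr_ge0 // mulr1 div1r lef_pV2 ?posrE; lra.
    + by case: dk => -[H _]; move: H; clear; lra.
    + exact: extremal_bound_le4 crude LE.
  move: s0 s3 HX H1 H2 G; clear; move: (extremal_bound L s kap) (s * half_res _ _) X.
  move=> G K X s0 s3 HX H1 H2 HG.
  case: HG => [[dE [[sE GE]|GE]]|[dE GE]];
  case: HX => [[_ HX]|[_ [HX|[HX|[HX|[HX|[HX|HX]]]]]]]; lra.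
Qed.

(** Here d >= 2/3 - z with z = 1 / (n - 3), so a large n makes s large; a small n
    makes the term 1 / (n - 4) large. *)
Lemma extremal_direct_lt (R : realFieldType) (L n : nat) (s d : R) :
  (1 < L)%N -> 0 < s -> s * L%:R = d -> 3 * s <= 1 -> (7 <= n)%N ->
  2 / 3 - (n%:R - 3)^-1 <= d ->
  extremal_bound L s (n%:R / 4) + unit_bound 7 s < s * (half_res R L + (n%:R - 4)^-1).
Proof.
move=> L1 s0 sL s3 n7 dn; rewrite mulrDr.
have s1 : s <= 1 by lra.
have n7' : 7 <= n%:R :> R by rewrite ler_nat.
have k0 : 0 < n%:R / 4 :> R by clear -n7'; lra.
have crude := extremal_bound_crude (ltnW L1) k0 s1.
have -> : unit_bound 7 s = 2 / 63 + 45 / 392 * s by rewrite /unit_bound; field.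
have [n8|n8] := leqP 8 n; last first.
  have nE : n = 7%N by apply/eqP; rewrite eqn_leq n7 -ltnS n8.
  have y7 : (7%:R - 4)^-1 = 1 / 3 :> R by field.
  have z7 : (7%:R - 3)^-1 = 1 / 4 :> R by field.
  have d7 : 5 / 12 <= d by move: dn; rewrite nE z7; clear; lra.
  rewrite nE y7 in crude *.
  have e2 : L = 2%N -> extremal_bound L s (7 / 4) = (1 - s) * (7 / 72).
    by move=> LE; rewrite /extremal_bound LE; field.
  have e3 := extremal_bound_le3 crude; have e4 := extremal_bound_le4 s1 crude.
  move: e2 e3 e4; clear crude; move: (extremal_bound L s (7 / 4)) => G e2 e3 e4.
  case: (half_res_cases L1 s0 sL) => -[LE H1 H2]; [move: (e2 LE)|move: (e3 LE)|move: (e4 LE)];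
    move: s0 s3 H1 H2 d7; clear; move: (s * half_res _ _) => K; lra.
have n8' : 8 <= n%:R :> R by rewrite ler_nat.
set z := (n%:R - 3)^-1 in dn; set y := (n%:R - 4)^-1.
have z0 : 0 < z by rewrite invr_gt0; lra.
have zy : z <= y by rewrite lef_pV2 ?posrE; lra.
have z5 : z <= 1 / 5 by rewrite div1r lef_pV2 ?posrE; lra.
have sy : s * z <= s * y by rewrite ler_wpM2l // ltW.
have zz : z * z <= z / 5 by have := ler_wpM2l (ltW z0) z5; rewrite mulrA mulr1.
have e2 : L = 2%N -> extremal_bound L s (n%:R / 4) <= (1 - s) / 8.
  by move=> LE; move: crude; rewrite LE; lra.
have e3 := extremal_bound_le3 crude; have e4 := extremal_bound_le4 s1 crude.
move: e2 e3 e4; clear crude; move: (extremal_bound L s _) => G e2 e3 e4.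
case: (half_res_cases L1 s0 sL) => -[LE H1 H2].
- have sz : (1 / 3 - z / 2) * z <= s * z.
    by rewrite ler_wpM2r ?(ltW z0) //; move: dn H2; clear; lra.
  move: (e2 LE) s0 s3 z0 z5 dn sy zz sz H1 H2; clear; move: (s * half_res _ _) (s * y) => K Y; lra.
- have sz : (2 / 9 - z / 3) * z <= s * z.
    by rewrite ler_wpM2r ?(ltW z0) //; move: dn H2; clear; lra.
  move: (e3 LE) s0 s3 z0 z5 dn sy zz sz H1 H2; clear; move: (s * half_res _ _) (s * y) => K Y; lra.
- have sy0 : 0 <= s * y by apply: le_trans sy; rewrite mulr_ge0 // ltW.
  move: (e4 LE) s0 s3 z0 z5 dn sy0 H1 H2; clear; move: (s * half_res _ _) (s * y) => K Y; lra.
Qed.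

(** The case d = 1/2, L = 2 is too tight for [extremal_bound], which is why the cost
    G of g is a parameter. *)
Lemma extremal_closed_lt (R : realFieldType) (L : nat) (s d G kap : R) :
  (1 < L)%N -> 0 < s -> s * L%:R = d -> s <= 1 ->
  G <= extremal_bound L s kap ->
  [\/ [/\ d = 1 / 2, kap = 2 & L = 2%N -> G <= 1 / 15],
      11 / 20 <= d /\ kap = 9 / 4 | 7 / 12 <= d /\ 0 < kap] ->
  G + unit_bound 8 s < s * half_res R L.
Proof.
move=> L1 s0 sL s1 GE dk.
have k0 : 0 < kap by case: dk => [[_ -> _]|[_ ->]|[]]; lra.
have crude := extremal_bound_crude (ltnW L1) k0 s1.
have -> : unit_bound 8 s = 1 / 40 + 27 / 256 * s by rewrite /unit_bound; field.
have e3 := extremal_bound_le3 crude; have e4 := extremal_bound_le4 s1 crude.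
case: (half_res_cases L1 s0 sL) => -[LE H1 H2].
- have {}GE : [\/ d = 1 / 2 /\ G <= 1 / 15, 11 / 20 <= d /\ G <= (1 - s) * (9 / 88)
     | 7 / 12 <= d /\ G <= (1 - s) / 8].
    case: dk => [[d2 _ G2]|[d9 kE]|[d10 _]]; [constructor 1|constructor 2|constructor 3]; split=> //.
    + exact: G2.
    + by apply: (le_trans GE); rewrite /extremal_bound LE kE le_eqVlt; apply/orP; left; apply/eqP; field.
    + by apply: (le_trans GE); move: crude; rewrite LE; lra.
  by case: GE => -[d2 GE]; move: d2 GE s0 H1 H2; clear; move: (s * half_res _ _) => K; lra.
- have {}GE : (d = 1 / 2 /\ G <= (1 - s) / 14) \/ 11 / 20 <= d /\ G <= (1 - s) / 12.
    case: dk => [[d2 kE _]|[d9 _]|[d10 _]]; [left|right|right]; split=> //.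
    + by apply: (le_trans GE); rewrite /extremal_bound LE kE le_eqVlt; apply/orP; left; apply/eqP; field.
    + exact: le_trans (e3 LE).
    + by move: d10; clear; lra.
    + exact: le_trans (e3 LE).
  by case: GE => -[d2 GE]; move: d2 GE s0 H1 H2; clear; move: (s * half_res _ _) => K; lra.
- have {}GE := le_trans GE (e4 LE).
  have {}dk : 1 / 2 <= d by case: dk => [[-> _ _]|[d2 _]|[d2 _]] //; move: d2; clear; lra.
  by move: dk GE s0 H1 H2; clear; move: (s * half_res _ _) => K; lra.
Qed.

(** * Costs of the threads of a graph *)

Lemma C_cost (R : realFieldType) (T : finType) (e : rel T) (h : othread e) m :
  C_ R h m = cost (s_ R e) (olen h)%:R (delta_ R h) (a_ R h) m%:R (rho_ R h).
Proof. by rewrite /C_ /cost /eps_ /t_ /tau_ natr1. Qed.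

Section Threads.
Variables (R : realFieldType) (T : finType) (e : rel T).
Hypotheses (e_sym : symmetric e) (e_irr : irreflexive e).
Implicit Types h g : othread e.
Local Notation p h := (deg e (first (val h))).
Local Notation q h := (deg e (final (val h))).
Local Notation s := (s_ R e).

Lemma rho_ge0 h : 0 <= rho_ R h.
Proof.
have := @rho_ge T e e_sym R h 1; rewrite ler01 lexx => /(_ isT).
rewrite subrr expr0n mulr0 addr0 expr1n mulr1 !mulr0 mul0rn addr0.
move=> H; rewrite leNgt; apply/negP => r0.
have k0 : 0 <= (olen h)%:R^-1 + ((q h)%:R - 1) :> R.
  by rewrite addr_ge0 ?invr_ge0 ?ler0n // subr_ge0 ler1n (leq_trans _ (final_branch h)).
by have := mulr_le0_ge0 (ltW r0) k0; lra.
Qed.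

Lemma p_ge3 h : (3 <= p h)%N. Proof. exact: first_branch. Qed.
Lemma q_ge3 h : (3 <= q h)%N. Proof. exact: final_branch. Qed.

Lemma delta_E h : delta_ R h = 1 - (p h)%:R^-1 - (q h)%:R^-1.
Proof. by []. Qed.

Lemma delta_ge13 h : 1 / 3 <= delta_ R h.
Proof.
have := @delta_ge_num R 3 3 (p h) (q h) isT (p_ge3 h) (q_ge3 h) isT.
by rewrite (leq_add (p_ge3 h) (q_ge3 h)) -delta_E => /(_ isT); lra.
Qed.

Lemma s_le h : s * (olen h)%:R <= delta_ R h.
Proof.
rewrite -ler_pdivlMr ?olen_gt0 //.
exact: (bigmin_le_cond _ (fun h => delta_ R h / (olen h)%:R)).
Qed.

Lemma s_attained : s < 3^-1 -> exists g, s * (olen g)%:R = delta_ R g.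
Proof.
move=> s3; suff [sE|[g sE]] : s = 3^-1 \/ exists g, s = delta_ R g / (olen g)%:R.
- by rewrite sE ltxx in s3.
- by exists g; rewrite sE divfK // gt_eqF ?olen_gt0.
rewrite /s_; elim/big_ind: _ => [|x y Hx Hy|g _]; [by left| |by right; exists g].
by rewrite /Order.min; case: ifP.
Qed.

Lemma s_gt0 : 0 < s.
Proof.
rewrite /s_; elim/big_ind: _ => [|x y x0 y0|g _]; first by rewrite invr_gt0.
  by rewrite lt_min x0.
by rewrite divr_gt0 ?olen_gt0 //; have := delta_ge13 g; lra.
Qed.

Lemma rho_long h : 1 <= rho_ R h * ((olen h)%:R^-1 + (p h + q h)%:R / 4).
Proof.
have := @rho_ge T e e_sym R h (1 / 2).
have c01 : 0 <= (1 / 2 : R) <= 1 by apply/andP; split; lra.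
move=> /(_ c01) /le_trans; apply; rewrite natrD.
have rho0 : 0 <= rho_ R h by apply: rho_ge0.
apply: ler_wpM2l => //; case: (_ && _); rewrite ?mulr1n ?mulr0n; lra.
Qed.

(** Without an edge u v every other thread between the ends has length at least
    two, and the potential 1/2 charges it to u and v only. *)
Lemma rho_nondirect h : ~~ e (first (val h)) (final (val h)) ->
  1 <= rho_ R h * ((olen h)%:R^-1 + ((p h + q h)%:R - 2) / 4).
Proof.
move=> nd; have := @rho_ge T e e_sym R h (1 / 2).
have c01 : 0 <= (1 / 2 : R) <= 1 by apply/andP; split; lra.
move=> /(_ c01); rewrite (negPf nd) andbF mulr0n addr0 natrD.
by congr (_ <= _ * _); field; rewrite gt_eqF ?olen_gt0.
Qed.

(** The value of c is the optimal one, the potential of the other vertices when all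
    of them are merged. *)
Lemma rho_unit h : olen h = 1%N ->
  (p h)%:R + (q h)%:R - 2 <= rho_ R h * ((p h)%:R * (q h)%:R - 1).
Proof.
move=> h1.
have p3 : 3 <= (p h)%:R :> R by rewrite ler_nat p_ge3.
have q3 : 3 <= (q h)%:R :> R by rewrite ler_nat q_ge3.
have := @rho_ge T e e_sym R h (((p h)%:R - 1) / ((p h)%:R + (q h)%:R - 2)).
rewrite h1 ltnn /= mulr0n addr0; move: (p h)%:R (q h)%:R p3 q3 => a b a3 b3.
have n0 : 0 < a + b - 2 by lra.
have c01 : 0 <= (a - 1) / (a + b - 2) <= 1.
  by rewrite divr_ge0 ?ler_pdivrMr //=; lra.
move=> /(_ c01).
have -> : 1%:R^-1 + (a - 1) * (1 - (a - 1) / (a + b - 2)) ^+ 2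
    + (b - 1) * ((a - 1) / (a + b - 2)) ^+ 2 = (a * b - 1) / (a + b - 2) :> R.
  by field; rewrite gt_eqF.
by rewrite mulrA ler_pdivlMr // mul1r.
Qed.

Hypothesis s3 : s < 3^-1.
Let s1 : s <= 1. Proof. by apply: ltW; apply: lt_trans s3 _; rewrite invf_lt1 // ltr1n. Qed.

Lemma C_unit h (m : 'I_(olen h)) : olen h = 1%N ->
  C_ R h m <= unit_bound ((p h)%:R + (q h)%:R) s.
Proof.
move=> h1; have m0 : (m : nat) = 0%N.
  by have := ltn_ord m; move: (m : nat) => k; rewrite h1; case: k.
rewrite C_cost m0 h1; apply: cost_unit.
- by rewrite ler_nat p_ge3.
- by rewrite ler_nat q_ge3.
- by rewrite (ltW s_gt0) s1.
- exact: rho_unit.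
Qed.

Lemma C_unit_le h (m : 'I_(olen h)) (n : R) : olen h = 1%N -> 6 <= n ->
  n <= (p h)%:R + (q h)%:R -> C_ R h m <= unit_bound n s.
Proof.
move=> h1 n6 np; apply: le_trans (C_unit m h1) _.
by apply: unit_bound_le => //; apply: ltW s_gt0.
Qed.

Lemma unit_bound6 : unit_bound 6 s = 1 / 24 + s / 8.
Proof. by rewrite /unit_bound; field. Qed.

Lemma C_unit6 h (m : 'I_(olen h)) : olen h = 1%N -> C_ R h m <= 1 / 24 + s / 8.
Proof.
move=> h1; rewrite -unit_bound6; apply: C_unit_le => //.
by rewrite -natrD ler_nat (leq_add (p_ge3 h) (q_ge3 h)).
Qed.

Lemma C_long h (m : 'I_(olen h)) : C_ R h m <= 1 / 24 + s / 5.
Proof.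
have s0 := s_gt0.
have [h2|h1] := ltnP 1 (olen h).
  rewrite C_cost; apply: (cost_long (p_ge3 h) (q_ge3 h) (ltn_ord m) h2 (ltW s0) s1).
    exact: s_le.
  exact: rho_long.
have {}h1 : olen h = 1%N by apply/eqP; rewrite eqn_leq h1 -(ltr0n R) olen_gt0.
by apply: le_trans (C_unit6 m h1) _; lra.
Qed.

Lemma C_extremal h (m : 'I_(olen h)) (kap : R) : s * (olen h)%:R = delta_ R h ->
  0 < kap -> 1 <= rho_ R h * ((olen h)%:R^-1 + kap) ->
  C_ R h m <= extremal_bound (olen h) s kap.
Proof.
move=> sL k0 rk; rewrite C_cost.
have /andP[a0 _] := @inv_nat_bounds R _ (p_ge3 h).
have /andP[b0 _] := @inv_nat_bounds R _ (q_ge3 h).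
have [j jE] : exists j : nat, (olen h = m + j + 1)%N.
  by exists (olen h - m.+1)%N; rewrite addn1 -addSn subnKC.
apply: (@cost_extremal R s (olen h)%:R (a_ R h) (b_ R h) m%:R j%:R) => //.
- by rewrite [in LHS]jE !natrD.
- by rewrite -/(delta_ R h); have := delta_ge13 h; lra.
Qed.
End Threads.

(** * The surroundings of a thread *)

Lemma loop_inj (T : finType) (e : rel T) (w : walk T) i j : is_loop e w ->
  (0 < i <= len w)%N -> (0 < j <= len w)%N -> (vtx w i == vtx w j) = (i == j).
Proof.
move=> lw; have L3 := loop_len lw; case/andP: lw => /and5P[_ op _ _ _] /eqP cl.
have uw : uniq w.2.
  case/orP: op => [/andP[_ u]|/and4P[]//]; by move: u => /= /andP[].
case: i => // i iL; case: j => // j jL.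
by rewrite /vtx /= nth_uniq.
Qed.

Section OffThread.
Variables (T : finType) (e : rel T).
Hypotheses (e_sym : symmetric e) (e_irr : irreflexive e).
Variable g : othread e.
Hypothesis L2 : (1 < olen g)%N.
Local Notation u := (first (val g)).
Local Notation v := (final (val g)).

Lemma on_thread_branch z : on_thread g z -> is_branch e z -> z = u \/ z = v.
Proof.
case/on_threadP => i iL ->{z} bz.
case: (posnP i) => [->|i0]; first by left.
have [->|iL'] := eqVneq i (olen g); first by right; rewrite -vtx_final.
have : (0 < i < olen g)%N by rewrite i0 ltn_neqAle iL'.
by move=> /(arc_deg (othread_arc g))/deg2_branch; rewrite bz.
Qed.

(** Applied to a thread of length at least two, it yields a core vertex of degree
    two off g. *)
Lemma unshared_off f : ~ share g f -> (1 < olen f)%N -> ~~ on_thread g (vtx (val f) 1).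
Proof.
move=> ns f2; apply/on_threadP => -[i iL E]; apply: ns.
have d1 : deg e (vtx (val f) 1) = 2%N by apply: (arc_deg (othread_arc f)).
have [i0|i0] := posnP i.
  by have := deg2_branch d1; rewrite E i0 (arc_head (othread_arc g)).
have [iE|iL'] := eqVneq i (olen g).
  by have := deg2_branch d1; rewrite E iE (arc_last (othread_arc g)).
by exists i, 1%N; split; rewrite // i0 ltn_neqAle iL'.
Qed.

(** An end z of g, its neighbour z' on g and the other end y. *)
Definition thread_end (z z' y : T) : Prop :=
  (z = u /\ z' = vtx (val g) 1 /\ y = v) \/
  (z = v /\ z' = vtx (val g) (olen g).-1 /\ y = u).

Lemma end_nbr (z z' y : T) : thread_end z z' y ->
  [/\ e z z', z' != y, is_core e z', is_core e y & is_branch e z] /\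
  (forall x, on_thread g x -> e z x -> x = z' \/ x = y).
Proof.
have ag := othread_arc g; have uv := ordinary_final_neq g.
have neq i j : (i <= olen g)%N -> (j <= olen g)%N ->
    (vtx (val g) i == vtx (val g) j) = (i == j).
  by move=> iL jL; apply/eqP/eqP => [/othread_inj->|->].
have vE : v = vtx (val g) (olen g) by rewrite -vtx_final.
case=> [[-> [-> ->]]|[-> [-> ->]]]; split.
- split; rewrite ?(othread_first_edge) //.
  + by rewrite vE neq ?(ltnW L2) // ltn_eqF.
  + by apply: inner_core.
  + exact/branch_core/final_branch.
  + exact: first_branch.
- move=> x /on_threadP[i iL ->] eux.
  have [i0|i0] := posnP i; first by rewrite i0 e_irr in eux.
  have [iE|iL'] := eqVneq i (olen g); first by right; rewrite iE vE.
  left; have iL2 : (0 < i < olen g)%N by rewrite i0 ltn_neqAle iL'.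
  rewrite e_sym in eux.
  have [/eqP|/eqP] := arc_nbr e_sym ag iL2 eux; rewrite -vtx_first neq //; try lia.
  by move=> E; congr vtx; lia.
- split=> //.
  + by rewrite e_sym othread_last_edge.
  + by rewrite -vtx_first neq ?leq_pred //; lia.
  + by apply: inner_core => //; lia.
  + exact/branch_core/first_branch.
  + exact: final_branch.
- move=> x /on_threadP[i iL ->] eux.
  have [i0|i0] := posnP i; first by right; rewrite i0.
  have [iE|iL'] := eqVneq i (olen g); first by rewrite iE -vE e_irr in eux.
  left; have iL2 : (0 < i < olen g)%N by rewrite i0 ltn_neqAle iL'.
  rewrite e_sym in eux.
  have [/eqP|/eqP] := arc_nbr e_sym ag iL2 eux; rewrite vE neq //; try lia.
  by move=> E; congr vtx; lia.
Qed.

(** The end z has a third neighbour besides z' and y.  It is off g, hence inner to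
    a loop thread, whose root must be z; the two edges of the loop at z make the
    degree at least four. *)
Lemma closed_end_deg (z z' y : T) : thread_end z z' y ->
  e u v -> (forall w, is_core e w -> on_thread g w) ->
  (4 <= deg e z)%N /\ exists w, ~~ on_thread g w.
Proof.
move=> zE euv closed.
have [[ez z'y cz' cy bz] on] := end_nbr zE.
have ezy : e z y by case: zE => -[-> [_ ->]]; rewrite // e_sym.
have /existsP[x /and3P[ezx xz' xy]] : [exists x, [&& e z x, x != z' & x != y]].
  apply: contraLR bz; rewrite negb_exists => /forallP nx.
  rewrite /is_branch -ltnNge ltnS.
  have -> : 2%N = #|[set z'; y]| by rewrite cards2 z'y.
  apply/subset_leq_card/subsetP => x; rewrite !inE => ex.
  by have := nx x; rewrite ex /= negb_and !negbK.
have xoff : ~~ on_thread g x.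
  by apply/negP => /on /(_ ezx)[] E; [rewrite E eqxx in xz'|rewrite E eqxx in xy].
split; last by exists x.
have : ~~ is_core e x by apply: contra xoff; apply: closed.
rewrite negbK => /existsP[w /andP[lw xw]].
have aw := loop_arc lw.
have [k1 k2 k3] : [/\ (0 < 1 < len w)%N, (0 < (len w).-1 < len w)%N & (1 < (len w).-1)%N].
  by have := loop_len lw; case: (len w) => [|[|[|n]]] // _; split=> //=; rewrite ltnSn.
have /innerP[i iL xE] := xw.
have zr : z = first w by apply: (loop_root e_sym lw iL) => //; rewrite -xE e_sym.
have zr' : z = final w by case/andP: lw => _ /eqP <-.
set w1 := vtx w 1; set w2 := vtx w (len w).-1.
have nc j : (0 < j < len w)%N -> ~~ is_core e (vtx w j).
  by move=> jL; rewrite negbK; apply/existsP; exists w; rewrite lw; apply/innerP; exists j.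
have n1 : ~~ is_core e w1 by apply: nc.
have n2 : ~~ is_core e w2 by apply: nc.
have [l0 l1] : (0 < len w)%N /\ (0 < (len w).-1)%N.
  by case/andP: k1 => _ /ltnW; case/andP: k2.
have ew1 : e z w1 by rewrite zr -vtx_first; apply: (arc_edge aw).
have ew2 : e z w2.
  rewrite e_sym zr' -vtx_final -[X in vtx w X](prednK l0).
  by apply: (arc_edge aw); rewrite prednK.
have w12 : w1 != w2.
  have h2 : (0 < (len w).-1 <= len w)%N by rewrite l1 leq_pred.
  by rewrite (loop_inj (i := 1) lw l0 h2) ltn_eqF.
have -> : 4%N = size [:: z'; y; w1; w2] by [].
rewrite /deg -(card_uniqP _) //.
  apply/subset_leq_card/subsetP => t; rewrite !inE => /or4P[] /eqP-> //.
have nn a b : is_core e a -> ~~ is_core e b -> a != b.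
  by move=> ca; apply: contraNneq => <-.
by rewrite /= !inE !negb_or z'y w12 !nn.
Qed.
End OffThread.

(** * Pairs of threads *)

Section Pair.
Variables (R : realFieldType) (T : finType) (e : rel T).
Hypotheses (e_sym : symmetric e) (e_irr : irreflexive e).
Hypothesis e_conn : forall x y : T, connect e x y.
Hypothesis min_deg : forall x : T, (2 <= deg e x)%N.
Hypothesis s3 : s_ R e < 3^-1.
Local Notation s := (s_ R e).
Local Notation D := (core_diam R e).
Local Notation p h := (deg e (first (val h))).
Local Notation q h := (deg e (final (val h))).

Lemma unit_edges (h : othread e) : olen h = 1%N ->
  edges (val h) = [set [set first (val h); final (val h)]].
Proof.
move=> h1; apply/setP => E; rewrite [in RHS]inE; apply/edgesP/eqP => [[i]|->].
  rewrite -/(olen h) h1 ltnS leqn0 => /eqP -> ->.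
  by rewrite -(vtx_final (val h)) -/(olen h) h1.
by exists 0%N; rewrite -?(vtx_final (val h)) -/(olen h) h1.
Qed.

Variable g : othread e.
Hypothesis sL : s * (olen g)%:R = delta_ R g.
Local Notation L := (olen g).
Local Notation u := (first (val g)).
Local Notation v := (final (val g)).

Lemma extremal_len : (1 < L)%N.
Proof.
rewrite ltnNge; apply/negP => L1.
have LE : L = 1%N by apply/eqP; rewrite eqn_leq L1 (arc_gt0 (othread_arc g)).
by have := delta_ge13 R g; rewrite -sL LE mulr1; move: s3; lra.
Qed.
Let L2 := extremal_len.

Let mL : (0 < L./2 < L)%N. Proof. by move: L2; clear; lia. Qed.

Let s0 : 0 < s := s_gt0 R e.
Let s_le1 : 3 * s <= 1. Proof. by move: s3; lra. Qed.
Let s1 : s <= 1. Proof. by move: s3; lra. Qed.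
Let d13 : 1 / 3 <= delta_ R g := delta_ge13 R g.

Definition off (w : T) : bool := ~~ on_thread g w && is_core e w.

Lemma diam_off w : off w -> half_res R L + (deg e w)%:R^-1 <= D.
Proof.
case/andP=> w_off cw; apply: (core_diam_hat R e_sym e_irr e_conn w_off mL cw).
exact: ltnW (min_deg w).
Qed.

Lemma diam_direct w : off w -> e u v ->
  half_res R L + ((p g + q g)%:R - 4)^-1 <= D.
Proof.
case/andP=> w_off cw euv.
have := core_diam_cut R e_sym e_irr e_conn w_off mL cw.
rewrite vtx_first vtx_final; apply=> //.
by have := leq_add (p_ge3 g) (q_ge3 g); apply: leq_trans.
Qed.

Section TwoThreads.
Variables (h k : othread e) (m_h : 'I_(olen h)) (m_k : 'I_(olen k)).

Lemma two_long : half_res R L + 1 / 2 <= D -> C_ R h m_h + C_ R k m_k < s * D.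
Proof.
move=> HD; apply: (@lt_le_trans _ _ (s * (half_res R L + 1 / 2))); last first.
  by rewrite ler_wpM2l // ltW.
apply: le_lt_trans (two_long_lt L2 s0 sL d13).
by apply: lerD; apply: C_long.
Qed.

(** Here delta_g = 1/3 forces both ends of g to have degree three. *)
Lemma tie_gt1 w : off w -> deg e w = 3%N -> L = 3%N -> delta_ R g <= 1 / 3 -> 1 < D.
Proof.
case/andP=> w_off cw dw L3 dg.
apply: (core_diam_tie R e_sym e_irr e_conn w_off mL L3 _ cw dw).
have /andP[_ a1] := inv_nat_bounds R (p_ge3 g); have /andP[_ b1] := inv_nat_bounds R (q_ge3 g).
have pE : (p g)%:R^-1 = 1 / 3 :> R.
  by apply/eqP; rewrite eq_le a1 /=; move: dg b1; rewrite delta_E; lra.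
apply/eqP; rewrite -(eqr_nat R) -(inj_eq invr_inj) vtx_first pE div1r //.
Qed.

Lemma tie_lt w : off w -> deg e w = 3%N -> L = 3%N -> delta_ R g <= 1 / 3 ->
  C_ R h m_h + C_ R k m_k <= 1 / 9 -> C_ R h m_h + C_ R k m_k < s * D.
Proof.
move=> ow dw L3 dg HC; have D1 := tie_gt1 ow dw L3 dg.
have sE : s = 1 / 9.
  by have := sL; rewrite L3 => sL3; move: d13 dg sL3; lra.
apply: le_lt_trans HC _; rewrite sE; move: D1; lra.
Qed.

Lemma unit_pair w : olen h = 1%N -> olen k = 1%N -> off w -> (3 <= deg e w)%N ->
  w = first (val h) \/ w = final (val h) ->
  C_ R h m_h + C_ R k m_k < s * D.
Proof.
move=> h1 k1 ow dw3 wh.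
have Ck := C_unit6 e_sym s3 m_k k1; have Ch6 := C_unit6 e_sym s3 m_h h1.
have nh : (deg e w)%:R + 3 <= (p h)%:R + (q h)%:R :> R.
  rewrite -!natrD ler_nat.
  by case: wh => ->; rewrite ?leq_add2l ?q_ge3 // addnC leq_add2r p_ge3.
have dw3' : 3 <= (deg e w)%:R :> R by rewrite ler_nat.
have Ch : C_ R h m_h <= unit_bound ((deg e w)%:R + 3) s.
  by apply: C_unit_le => //; lra.
have [dw|/eqP dwn] := eqVneq (deg e w) 3%N; have [L3|/eqP L3n] := eqVneq L 3%N;
  have [dg|dg] := lerP (delta_ R g) (1 / 3).
- apply: (tie_lt ow dw L3 dg).
  have sL3 := sL; rewrite L3 in sL3.
  by move: Ck Ch6 sL3 dg; lra.
all: apply: (@lt_le_trans _ _ (s * (half_res R L + (deg e w)%:R^-1)));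
  last by rewrite ler_wpM2l ?(ltW s0) ?diam_off.
all: apply: le_lt_trans (lerD Ch Ck) _; apply: (two_unit_lt L2 s0 sL d13 dw3) => //.
Qed.
End TwoThreads.

Section Extremal.
Variables (h : othread e) (m_h : 'I_(olen h)) (m_g : 'I_L).
Hypothesis h1 : olen h = 1%N.

Lemma delta_ge_sum r : (0 < r)%N -> (3 + r <= p g + q g)%N ->
  1 - 3^-1 - r%:R^-1 <= delta_ R g.
Proof. exact: (@delta_ge_num R 3 r (p g) (q g) isT (p_ge3 g) (q_ge3 g)). Qed.

Lemma delta6 : (p g + q g)%N = 6%N -> delta_ R g = 1 / 3.
Proof.
move=> n6; have pE : p g = 3%N by have := p_ge3 g; have := q_ge3 g; lia.
have qE : q g = 3%N by have := p_ge3 g; lia.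
by rewrite delta_E pE qE; lra.
Qed.

Lemma C_g_le : C_ R g m_g <= extremal_bound L s ((p g + q g)%:R / 4).
Proof.
apply: C_extremal => //; last exact: rho_long.
by rewrite divr_gt0 // ltr0n (leq_trans _ (leq_add (p_ge3 g) (q_ge3 g))).
Qed.

(** Adjacent ends of degree three are excluded because kap = 3/2 would be too large;
    there the cut gives D >= lam + 1/2 instead. *)
Lemma extremal_pair w : off w -> (3 <= deg e w)%N ->
  w = first (val h) \/ w = final (val h) ->
  ((p g + q g)%N = 6%N -> ~~ e u v) ->
  C_ R h m_h + C_ R g m_g < s * D.
Proof.
move=> ow dw3 wh nd.
have Ch6 := C_unit6 e_sym s3 m_h h1.
have nh : (deg e w)%:R + 3 <= (p h)%:R + (q h)%:R :> R.
  rewrite -!natrD ler_nat.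
  by case: wh => ->; rewrite ?leq_add2l ?q_ge3 // addnC leq_add2r p_ge3.
have dw3' : 3 <= (deg e w)%:R :> R by rewrite ler_nat.
have Ch : C_ R h m_h <= unit_bound ((deg e w)%:R + 3) s.
  by apply: C_unit_le => //; lra.
have n6 := leq_add (p_ge3 g) (q_ge3 g).
have [kap Ck kapP] : exists2 kap, C_ R g m_g <= extremal_bound L s kap &
    [/\ delta_ R g = 1 / 3 & kap = 1] \/
    [/\ 5 / 12 <= delta_ R g & kap = 7 / 4] \/ [/\ 7 / 15 <= delta_ R g & 0 < kap].
  have [nE|n7] := eqVneq (p g + q g)%N 6%N.
    exists 1; last by left; split; rewrite ?delta6.
    apply: C_extremal => //; have := rho_nondirect R e_sym (nd nE).
    by have -> : ((p g + q g)%:R - 2) / 4 = 1 :> R by rewrite nE; lra.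
  have {}n7 : (7 <= p g + q g)%N by rewrite ltn_neqAle eq_sym n7.
  have d5 := delta_ge_sum (r := 4) isT n7.
  exists ((p g + q g)%:R / 4); first exact: C_g_le.
  right; have [nE|n8] := eqVneq (p g + q g)%N 7%N.
    by left; split; rewrite ?nE //; move: d5; lra.
  have {}n8 : (8 <= p g + q g)%N by rewrite ltn_neqAle eq_sym n8.
  right; split; first by have := delta_ge_sum (r := 5) isT n8; lra.
  by rewrite divr_gt0 // ltr0n (leq_trans _ n8).
have main : (L = 3%N -> deg e w = 3%N -> 1 / 3 < delta_ R g) ->
    C_ R h m_h + C_ R g m_g < s * D.
  move=> tie; apply: (@lt_le_trans _ _ (s * (half_res R L + (deg e w)%:R^-1))).
    rewrite addrC; apply: le_lt_trans (lerD Ck Ch) _.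
    apply: (extremal_unit_lt L2 s0 sL s_le1 dw3) => //.
  by rewrite ler_wpM2l ?(ltW s0) ?diam_off.
have [dw|/eqP dwn] := eqVneq (deg e w) 3%N; have [L3|/eqP L3n] := eqVneq L 3%N;
  have [dg|dg] := lerP (delta_ R g) (1 / 3); try by apply: main.
apply: (tie_lt ow dw L3 dg).
have kE : kap = 1 by case: kapP => [[]//|[[d5 _]|[d5 _]]]; move: d5 dg; lra.
have sL3 := sL; rewrite L3 in sL3.
have -> : 1 / 9 = (1 - s) / 16 + (1 / 24 + s / 8) :> R.
  by case: kapP => [[dE _]|[[d5 _]|[d5 _]]]; move: sL3 dg; rewrite ?dE; lra.
have GE : extremal_bound L s kap = (1 - s) / 16 by rewrite /extremal_bound kE L3; field.
by rewrite GE in Ck; rewrite addrC; exact: (lerD Ck Ch6).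
Qed.

Hypothesis uh : (p h + q h = p g + q g)%N.
Hypothesis euv : e u v.

Lemma direct_pair w : off w -> (7 <= p g + q g)%N -> C_ R h m_h + C_ R g m_g < s * D.
Proof.
move=> ow n7.
have Ch : C_ R h m_h <= unit_bound 7 s.
  by apply: C_unit_le => //; rewrite ?ler_nat // -natrD uh ler_nat.
apply: (@lt_le_trans _ _ (s * (half_res R L + ((p g + q g)%:R - 4)^-1))).
  rewrite addrC; apply: le_lt_trans (lerD C_g_le Ch) _.
  apply: (extremal_direct_lt L2 s0 sL s_le1 n7).
  have := @delta_ge R 3 (p g) (q g) isT (p_ge3 g) (q_ge3 g); rewrite -delta_E.
  have -> : 2 / 3 = 1 - 3^-1 :> R by lra.
  by [].
by rewrite ler_wpM2l ?(ltW s0) ?(diam_direct ow).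
Qed.

(** The exact value of eps, 1/18, replaces its bound 1/16. *)
Lemma C_g_le_degree4 : p g = 4%N -> q g = 4%N -> L = 2%N -> C_ R g m_g <= 1 / 15.
Proof.
move=> pE qE LE; have dE : delta_ R g = 1 / 2 by rewrite delta_E pE qE; lra.
have sE : s = 1 / 4 by move: sL; rewrite LE dE; lra.
have rk := rho_long R e_sym g; rewrite pE qE LE in rk.
have m2 := ltn_ord m_g.
rewrite C_cost; move: (nat_of_ord m_g) m2 => m; rewrite LE => m2.
rewrite sE dE /a_ pE /cost; have -> : (2%:R - 1 / 2)^-1 = 2 / 3 :> R by field.
by move: rk; rewrite natrD; case: m m2 => [|[|m]] // _; lra.
Qed.

Lemma closed_pair : (forall w, is_core e w -> on_thread g w) ->
  C_ R h m_h + C_ R g m_g < s * D.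
Proof.
move=> closed.
have [p4 [w w_off]] :=
  closed_end_deg e_sym e_irr L2 (or_introl (conj erefl (conj erefl erefl))) euv closed.
have [q4 _] :=
  closed_end_deg e_sym e_irr L2 (or_intror (conj erefl (conj erefl erefl))) euv closed.
have n8 := leq_add p4 q4.
have Ch : C_ R h m_h <= unit_bound 8 s.
  by apply: C_unit_le => //; rewrite ?ler_nat // -natrD uh ler_nat.
have dn r : (0 < r)%N -> (4 + r <= p g + q g)%N -> 1 - 4^-1 - r%:R^-1 <= delta_ R g.
  exact: (@delta_ge_num R 4 r (p g) (q g) isT p4 q4).
apply: (@lt_le_trans _ _ (s * half_res R L)); last first.
  rewrite ler_wpM2l ?(ltW s0) //.
  exact: (core_diam_hat0 R e_sym e_conn w_off mL).
rewrite addrC; apply: le_lt_trans (lerD (lexx _) Ch) _.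
apply: (extremal_closed_lt L2 s0 sL s1 C_g_le).
have [n8E|n8N] := eqVneq (p g + q g)%N 8%N.
  have [pE qE] : p g = 4%N /\ q g = 4%N by move: p4 q4 n8E; clear; lia.
  have dE : delta_ R g = 1 / 2 by rewrite delta_E pE qE; lra.
  constructor 1; split=> //; first by rewrite n8E; lra.
  move=> LE; exact: C_g_le_degree4.
have {}n9 : (9 <= p g + q g)%N by rewrite ltn_neqAle eq_sym n8N.
have [nE|n9N] := eqVneq (p g + q g)%N 9%N.
  by constructor 2; split; [have := dn 5%N isT n9; lra | rewrite nE].
have {}n10 : (10 <= p g + q g)%N by rewrite ltn_neqAle eq_sym n9N.
constructor 3; split; first by have := dn 6%N isT n10; lra.
by rewrite divr_gt0 // ltr0n (leq_trans _ n10).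
Qed.
End Extremal.
End Pair.

Section Main.
Variables (R : realFieldType) (T : finType) (e : rel T).
Hypotheses (e_sym : symmetric e) (e_irr : irreflexive e).
Hypothesis e_conn : forall x y : T, connect e x y.
Hypothesis min_deg : forall x : T, (2 <= deg e x)%N.
Hypothesis s3 : s_ R e < 3^-1.
Local Notation s := (s_ R e).
Local Notation D := (core_diam R e).

Variable g : othread e.
Hypothesis sL : s * (olen g)%:R = delta_ R g.
Local Notation u := (first (val g)).
Local Notation v := (final (val g)).
Let L2 : (1 < olen g)%N := extremal_len s3 sL.

(** The only branch vertices on g are its ends. *)
Lemma off_or_ends (f : othread e) :
  (exists2 w, off g w & w = first (val f) \/ w = final (val f)) \/
  ((first (val f) = u /\ final (val f) = v) \/ (first (val f) = v /\ final (val f) = u)).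
Proof.
have bf : is_branch e (first (val f)) := first_branch f.
have bl : is_branch e (final (val f)) := final_branch f.
have [o1|n1] := boolP (on_thread g (first (val f))); last first.
  by left; exists (first (val f)); [rewrite /off n1 branch_core|left].
have [o2|n2] := boolP (on_thread g (final (val f))); last first.
  by left; exists (final (val f)); [rewrite /off n2 branch_core|right].
right; have ne := ordinary_final_neq f.
have [E1|E1] := on_thread_branch o1 bf; have [E2|E2] := on_thread_branch o2 bl;
  rewrite E1 E2 ?eqxx // in ne *; [by left|by right].
Qed.

Lemma pair_lt (h k : othread e) (m_h : 'I_(olen h)) (m_k : 'I_(olen k)) :
  ~ share g h -> ~ share g k \/ k = g -> ~~ same_thread h k ->
  C_ R h m_h + C_ R k m_k < s * D.
Proof.
move=> nsh kg hk.
(* Such a vertex gives D >= lam + 1/2, which is enough for any two threads. *)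
have [/existsP[w /andP[ow /eqP dw]]|no2] := boolP [exists w, off g w && (deg e w == 2%N)].
  apply: (two_long e_sym s3 sL); rewrite div1r.
  by have := diam_off e_sym e_irr e_conn min_deg s3 sL ow; rewrite dw.
have deg3 w : off g w -> (3 <= deg e w)%N.
  move=> ow; rewrite ltn_neqAle min_deg andbT eq_sym.
  by move/existsPn: no2 => /(_ w); rewrite ow.
have unit (f : othread e) : ~ share g f -> olen f = 1%N.
  move=> ns; apply/eqP; rewrite eqn_leq (arc_gt0 (othread_arc f)) andbT leqNgt.
  apply/negP => f2; have o1 : off g (vtx (val f) 1).
    by rewrite /off unshared_off // inner_core.
  by have := deg3 _ o1; rewrite (arc_deg (othread_arc f)).
have h1 := unit h nsh.
have direct_edge (f : othread e) : olen f = 1%N ->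
    (first (val f) = u /\ final (val f) = v) \/ (first (val f) = v /\ final (val f) = u) ->
    e u v /\ edges (val f) = [set [set u; v]].
  move=> f1 fE; have ef : e (first (val f)) (final (val f)).
    by rewrite -(vtx_final (val f)) -/(olen f) f1; exact: (othread_first_edge f).
  rewrite unit_edges //; move: ef.
  by case: fE => -[-> ->]; rewrite // e_sym setUC.
case: kg => [nsk|kE].
  have k1 := unit k nsk.
  have [[w ow wh]|hE] := off_or_ends h.
    exact: (unit_pair e_sym e_irr e_conn min_deg s3 sL m_h m_k h1 k1 ow (deg3 w ow) wh).
  have [[w ow wk]|kE] := off_or_ends k.
    rewrite addrC.
    exact: (unit_pair e_sym e_irr e_conn min_deg s3 sL m_k m_h k1 h1 ow (deg3 w ow) wk).
  by rewrite /same_thread (direct_edge h h1 hE).2 (direct_edge k k1 kE).2 eqxx in hk.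
subst k.
(* With a core vertex off g, adjacent ends of degree three give D >= lam + 1/2 too. *)
have cut6 w : off g w -> e u v -> (deg e u + deg e v)%N = 6%N ->
    C_ R h m_h + C_ R g m_k < s * D.
  move=> ow euv n6; apply: (two_long e_sym s3 sL).
  have := diam_direct e_sym e_irr e_conn s3 sL ow euv; rewrite n6.
  by have -> : (6%:R - 4)^-1 = 1 / 2 :> R by field.
have [[w ow wh]|hE] := off_or_ends h.
  have [/andP[/eqP n6 euv]|nd] := boolP (((deg e u + deg e v)%N == 6%N) && e u v).
    exact: cut6 ow euv n6.
  apply: (extremal_pair e_sym e_irr e_conn min_deg s3 sL m_h m_k h1 ow (deg3 w ow) wh).
  by move=> n6; move: nd; rewrite n6 eqxx.
have [euv _] := direct_edge h h1 hE.
have uh : (deg e (first (val h)) + deg e (final (val h)) = deg e u + deg e v)%N.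
  by case: hE => -[-> ->]; rewrite // addnC.
have [/existsP[w ow]|closed] := boolP [exists w, off g w].
  have [n6|n7] := eqVneq (deg e u + deg e v)%N 6%N; first exact: cut6 ow euv n6.
  apply: (direct_pair e_sym e_irr e_conn s3 sL m_h m_k h1 uh euv ow).
  by rewrite ltn_neqAle eq_sym n7 (leq_add (p_ge3 g) (q_ge3 g)).
apply: (closed_pair e_sym e_irr e_conn s3 sL m_h m_k h1 uh euv) => w cw.
by move/existsPn: closed => /(_ w); rewrite /off cw andbT negbK.
Qed.
End Main.

Theorem lemma6p1 (R : realFieldType) (T : finType) (e : rel T)
    (e_sym : symmetric e) (e_irr : irreflexive e)
    (e_conn : forall x y : T, connect e x y)
    (min_deg : forall x : T, (2 <= deg e x)%N)
    (not_cycle : ~ is_cycle_graph e)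
    (has_ordinary : (0 < #|othread e|)%N)
    (s_lt : s_ R e < 3^-1)
    (h k : othread e) (hk : ~~ same_thread h k)
    (m_h : 'I_(olen h)) (m_k : 'I_(olen k)) :
  C_ R h m_h + C_ R k m_k < s_ R e * core_diam R e.
Proof.
have nshare (f f' : othread e) : ~~ same_thread f f' -> ~ share f f'.
  by move=> /negP ns /(share_same_thread e_sym).
have kh : ~~ same_thread k h by rewrite /same_thread eq_sym.
have [sLk|nk] := eqVneq (s_ R e * (olen k)%:R) (delta_ R k).
  by apply: (pair_lt e_sym e_irr e_conn min_deg s_lt sLk) => //; [exact: nshare | right].
have [sLh|nh] := eqVneq (s_ R e * (olen h)%:R) (delta_ R h).
  rewrite addrC.
  by apply: (pair_lt e_sym e_irr e_conn min_deg s_lt sLh) => //; [exact: nshare | right].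
have [g sLg] := s_attained s_lt.
(* Length and delta depend on the thread only, so g is a third thread. *)
have sep (f : othread e) : s_ R e * (olen f)%:R != delta_ R f -> ~ share g f.
  move=> /eqP nf gf; apply: nf; have fg := share_sym gf.
  have <- : olen g = olen f by apply/eqP; rewrite eqn_leq !share_olen.
  rewrite sLg !delta_E; have ng := ordinary_final_neq g.
  have [E1|E1] := share_first e_sym gf; have [E2|E2] := share_final e_sym gf;
    rewrite E1 E2 ?eqxx // in ng *.
  by rewrite addrAC.
by apply: (pair_lt e_sym e_irr e_conn min_deg s_lt sLg) => //; [exact: sep | left; exact: sep].
Qed.
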